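(* Let $\delta>0$. Then: (a) for $b>a\ge0$ and $c>0$, the function $x\mapsto {}_1F_1(a+\delta;c;x)\,{}_1F_1(b;c;x)-{}_1F_1(b+\delta;c;x)\,{}_1F_1(a;c;x)$ has positive power series coefficients, starting with the coefficient at $x^2$; (b) the function $a\mapsto {}_1F_1(a+\delta;c;x)/{}_1F_1(a;c;x)$ is monotone decreasing on $[0,\infty)$ for fixed $c>0,x>0$, and on $(-\infty,c-\delta]$ for fixed $c>0>x$; so that $a\mapsto{}_1F_1(a;c;x)$ is log-concave, i.e. ${}_1F_1(a+\delta;c;x)^2\ge {}_1F_1(a;c;x)\,{}_1F_1(a+2\delta;c;x)$, on $[0,\infty)$ for fixed $c,x>0$ and on $(-\infty,c]$ for fixed $c>0>x$; (c) for $b>a>0$ and $c,x>0$, \[ \frac{\Gamma(a+\delta)\Gamma(b)}{\Gamma(b+\delta)\Gamma(a)}<\frac{{}_1F_1(b+\delta;c;x)\,{}_1F_1(a;c;x)}{{}_1F_1(a+\delta;c;x)\,{}_1F_1(b;c;x)}<1, \] and for $a<b<c-\delta$ and $c>0>x$, \[ \frac{\Gamma(c-a-\delta)\Gamma(c-b)}{\Gamma(c-b-\delta)\Gamma(c-a)}<\frac{{}_1F_1(b+\delta;c;x)\,{}_1F_1(a;c;x)}{{}_1F_1(a+\delta;c;x)\,{}_1F_1(b;c;x)}<1; \] both bounds in both inequalities are sharp: the upper bound $1$ is attained at $x=0$, and the lower bounds are the limits of the middle ratio as $x\to+\infty$ and $x\to-\infty$, respectively; (d) for $a>b>0$, $c>0$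 and every integer $m\ge 2$, \[ {}_4F_3\left(\begin{matrix}-m,\ a,\ 1-c-m,\ 1-am/(a+b)\\ c,\ 1-b-m,\ -am/(a+b)\end{matrix}\,\middle|\,-1\right)>0, \] and for $b>a>0$ the sign of this inequality is reversed.
   Context: $(a)_k=a(a+1)\cdots(a+k-1)$ is the Pochhammer symbol. The Kummer function is ${}_1F_1(a;c;x)=\sum_{k\ge0}\frac{(a)_k}{(c)_k}\frac{x^k}{k!}$. The generalized hypergeometric function is ${}_pF_q\left(\begin{matrix}a_1,\dots,a_p\\ b_1,\dots,b_q\end{matrix}\middle|x\right)=\sum_{n\ge0}\frac{(a_1)_n\cdots(a_p)_n}{(b_1)_n\cdots(b_q)_n}\frac{x^n}{n!}$; when an upper parameter is $-m$ the series terminates at $n=m$. $\Gamma$ is Euler's gamma function.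
   Formalization: In (d) the 4F3 is ill-defined (0/0 terms) when am/(a+b) is an integer, e.g. m=3, a=1, b=2; it is therefore read as the limit when the parameter am/(a+b) is replaced by e and e tends to am/(a+b), which equals the 4F3 value whenever am/(a+b) is not an integer. *)

(* Defs.v *)
From Stdlib Require Import Reals List Factorial.
From Coquelicot Require Import Coquelicot.
Open Scope R_scope.

Fixpoint poch (a : R) (k : nat) : R :=
  match k with
  | O => 1
  | S j => poch a j * (a + INR j)
  end.

Definition F11 (a c x : R) : R :=
  Series (fun k => poch a k / poch c k * x ^ k / INR (fact k)).

(** Generalized hypergeometric function pFq with upper parameters [A] and
    lower parameters [B]: sum_n (A_1)_n...(A_p)_n/((B_1)_n...(B_q)_n) x^n/n!.
    When an upper parameter is -m the terms vanish for n > m, so the series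
    terminates at n = m. *)
Definition prod_poch (L : list R) (n : nat) : R :=
  fold_right Rmult 1 (map (fun p => poch p n) L).

Definition pFq (A B : list R) (x : R) : R :=
  Series (fun n => prod_poch A n / prod_poch B n * x ^ n / INR (fact n)).

Definition Gamma (s : R) : R :=
  RInt_gen (fun t => Rpower t (s - 1) * exp (- t)) (at_right 0) (Rbar_locally p_infty).

Definition kratio (d a b c x : R) : R :=
  (F11 (b + d) c x * F11 a c x) / (F11 (a + d) c x * F11 b c x).

(* Main.v *)
(* The x^m coefficient of F(a+d) F(b) - F(b+d) F(a) is a sum over k of
   C(m,k) / ((c)_k (c)_(m-k)) times (a+d)_k (b)_(m-k) - (a)_k (b+d)_(m-k).
   After symmetrising in k <-> m-k, both the weight 1 / ((c)_k (c)_(m-k)) and the ratio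
   of the two Pochhammer products increase up to k = m/2, while without that weight
   the sums agree by Vandermonde; Chebyshev's sum inequality gives positivity. The
   case x < 0 follows by Kummer's transformation, and (d) is the case d = 1.

   For the lower bound, (a)_k (b+d)_k / ((a+d)_k (b)_k) decreases to the Gamma
   quotient L, so the coefficients of F(b+d) F(a) - L F(a+d) F(b) are positive.
   For its sharpness, a F(a+1;c;x) / (x F(a;c;x)) -> 1 shows that the middle ratio is
   asymptotic to (a)_n (b+d)_n / ((a+d)_n (b)_n) times the ratio at (a+n, b+n), which is
   less than 1; hence its upper limit is at most this quotient for each n, so at most L. *)

Require Import Defs.
From Stdlib Require Import Reals List Factorial Lra Lia.
From Coquelicot Require Import Coquelicot.
Open Scope R_scope.

(** * Pochhammer symbols *)

(** Before symmetrising, the ratio of [(a+d)_k (b)_(m-k)] to [(a)_k (b+d)_(m-k)] increases over the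
    whole range of [k], while the weight rises and then falls, so Chebyshev's inequality does not
    apply. Folding at [m/2] turns both into functions of [min(k, m-k)]. At [a = 0] denominators of
    these ratios vanish, so every comparison is cross-multiplied, and strictness is drawn from the
    index pair [1, 0] alone; the strict rise of the weight there requires [m >= 2]. The lower bound
    and its limit use [Gamma] only through positivity, the recursion [Gamma(s+1) = s Gamma(s)] and
    one inequality, [Gamma(A+d) Gamma(B) <= Gamma(B+d) Gamma(A)]; these take the place of Stirling's
    formula, as the contiguous quotient takes the place of the asymptotics of [F11]. In (d), raising
    a parameter by one multiplies [(a)_n] by [(a+n)/a]. The two products then differ by
    [(a)_n (b)_(m-n)] times a linear function of [n] with zero [am/(a+b)], which is where that
    parameter comes from. *)

Lemma poch_pos (a : R) (k : nat) : 0 < a -> 0 < poch a k.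
Proof.
  intros Ha; induction k as [|k IH]; simpl; [lra|].
  apply Rmult_lt_0_compat; [exact IH|]; pose proof (pos_INR k); lra.
Qed.

Lemma poch_nonneg (a : R) (k : nat) : 0 <= a -> 0 <= poch a k.
Proof.
  intros Ha; induction k as [|k IH]; simpl; [lra|].
  apply Rmult_le_pos; [exact IH|]; pose proof (pos_INR k); lra.
Qed.

Lemma poch_le (a b : R) (k : nat) : 0 <= a -> a <= b -> poch a k <= poch b k.
Proof.
  intros Ha Hab; induction k as [|k IH]; simpl; [lra|].
  pose proof (pos_INR k); apply Rmult_le_compat; try lra.
  apply poch_nonneg; lra.
Qed.

Lemma poch_add (a : R) (k l : nat) :
  poch a (k + l) = poch a k * poch (a + INR k) l.
Proof.
  induction l as [|l IH]; simpl.
  - rewrite Nat.add_0_r; ring.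
  - rewrite Nat.add_succ_r; simpl; rewrite IH, plus_INR; ring.
Qed.

Lemma poch_succ_l (a : R) (k : nat) : poch a (S k) = a * poch (a + 1) k.
Proof.
  change (S k) with (1 + k)%nat; rewrite poch_add; simpl; ring.
Qed.

Lemma poch_shift (a : R) (k : nat) : a * poch (a + 1) k = poch a k * (a + INR k).
Proof. rewrite <- poch_succ_l; reflexivity. Qed.

Lemma poch_1 (k : nat) : poch 1 k = INR (fact k).
Proof.
  induction k as [|k IH]; [reflexivity|].
  change (fact (S k)) with (S k * fact k)%nat.
  rewrite mult_INR, S_INR; simpl poch; rewrite IH; ring.
Qed.

(** The factors of [(1-y-m)_n] are the negatives of the last [n] factors of [(y)_m]. This rewrites
    the parameters [-m], [1-c-m] and [1-b-m] of (d). *)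
Lemma poch_reflect (y : R) (m n : nat) : (n <= m)%nat ->
  poch y (m - n) * poch (1 - y - INR m) n = (-1) ^ n * poch y m.
Proof.
  induction n as [|n IH]; intros Hn.
  - rewrite Nat.sub_0_r; simpl; ring.
  - simpl pow; rewrite Rmult_assoc, <- IH by lia.
    replace (m - n)%nat with (S (m - S n)) by lia; simpl poch.
    rewrite minus_INR, S_INR by lia; ring.
Qed.

Lemma poch_neg_nat_vanish (m n : nat) : (m < n)%nat -> poch (- INR m) n = 0.
Proof.
  intros H; replace n with (S m + (n - S m))%nat by lia.
  rewrite poch_add; simpl; ring.
Qed.

(** Convexity of [(y)_l] on [y >= 0], in the form used for two pairs with equal sum: the more spread
    pair [A, B + d] has the larger total. *)
Lemma poch_supermodular (A B d : R) (l : nat) : 0 <= A -> A <= B -> 0 <= d ->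
  poch B l + poch (A + d) l <= poch A l + poch (B + d) l.
Proof.
  intros HA HAB Hd; induction l as [|l IH]; simpl; [lra|].
  pose proof (pos_INR l).
  pose proof (poch_le A B l HA HAB).
  pose proof (poch_nonneg A l HA).
  assert (poch (A + d) l <= poch (B + d) l) by (apply poch_le; lra).
  assert (poch A l <= poch (A + d) l) by (apply poch_le; lra).
  nra.
Qed.

(** * Finite sums *)

Lemma sum_f_R0_pos_one (f : nat -> R) (n k : nat) : (k <= n)%nat ->
  (forall i, (i <= n)%nat -> 0 <= f i) -> 0 < f k -> 0 < sum_f_R0 f n.
Proof.
  revert k; induction n as [|n IH]; intros k Hk Hf Hp; simpl.
  - replace k with 0%nat in Hp by lia; exact Hp.
  - destruct (Nat.eq_dec k (S n)) as [->|Hne].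
    + assert (0 <= sum_f_R0 f n) by (rewrite <- (sum_eq_R0 (fun _ => 0) n) by reflexivity; apply sum_Rle; intros; apply Hf; lia).
      lra.
    + assert (0 < sum_f_R0 f n) by (apply IH with k; [lia|intros; apply Hf; lia|exact Hp]).
      pose proof (Hf (S n) ltac:(lia)); lra.
Qed.

Lemma sum_f_R0_symmetrize (f : nat -> R) (n : nat) :
  2 * sum_f_R0 f n = sum_f_R0 (fun k => f k + f (n - k)%nat) n.
Proof.
  rewrite plus_sum, (sum_f_R0_skip f n); ring.
Qed.

(* Chebyshev's sum inequality in determinant form: the difference of the two
   sides is half of [sum_{k,l} (w k - w l) (s k * t l - t k * s l)]. *)
Lemma chebyshev_sum_lt (w s t : nat -> R) (n k0 l0 : nat) :
  (k0 <= n)%nat -> (l0 <= n)%nat ->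
  (forall k l, (k <= n)%nat -> (l <= n)%nat ->
     0 <= (w k - w l) * (s k * t l - t k * s l)) ->
  0 < (w k0 - w l0) * (s k0 * t l0 - t k0 * s l0) ->
  sum_f_R0 (fun k => w k * t k) n * sum_f_R0 s n <
  sum_f_R0 (fun k => w k * s k) n * sum_f_R0 t n.
Proof.
  intros Hk0 Hl0 Hge Hgt.
  assert (Hpos : 0 < sum_f_R0 (fun k =>
    sum_f_R0 (fun l => (w k - w l) * (s k * t l - t k * s l)) n) n).
  { apply sum_f_R0_pos_one with k0; auto.
    - intros i Hi; rewrite <- (sum_eq_R0 (fun _ => 0) n) by reflexivity.
      apply sum_Rle; intros; apply Hge; auto.
    - apply sum_f_R0_pos_one with l0; auto. }
  assert (Heq : forall k,
    sum_f_R0 (fun l => (w k - w l) * (s k * t l - t k * s l)) n =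
    sum_f_R0 t n * (w k * s k) - sum_f_R0 s n * (w k * t k)
    - sum_f_R0 (fun l => w l * t l) n * s k
    + sum_f_R0 (fun l => w l * s l) n * t k).
  { intros k.
    rewrite (Rmult_comm (sum_f_R0 t n)), (Rmult_comm (sum_f_R0 s n)),
      (Rmult_comm (sum_f_R0 _ n) (s k)), (Rmult_comm (sum_f_R0 _ n) (t k)).
    rewrite !scal_sum, <- !minus_sum, <- plus_sum.
    apply sum_eq; intros; ring. }
  rewrite (sum_eq _ _ n (fun k _ => Heq k)) in Hpos.
  rewrite plus_sum, !minus_sum in Hpos.
  rewrite (sum_eq (fun i => sum_f_R0 t n * (w i * s i))
    (fun i => (w i * s i) * sum_f_R0 t n)) in Hpos by (intros; ring).
  rewrite (sum_eq (fun i => sum_f_R0 s n * (w i * t i))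
    (fun i => (w i * t i) * sum_f_R0 s n)) in Hpos by (intros; ring).
  rewrite (sum_eq (fun i => sum_f_R0 (fun l => w l * t l) n * s i)
    (fun i => s i * sum_f_R0 (fun l => w l * t l) n)) in Hpos by (intros; ring).
  rewrite (sum_eq (fun i => sum_f_R0 (fun l => w l * s l) n * t i)
    (fun i => t i * sum_f_R0 (fun l => w l * s l) n)) in Hpos by (intros; ring).
  rewrite <- !scal_sum in Hpos; lra.
Qed.

Lemma binomial_coef_pos (m k : nat) : 0 < Binomial.C m k.
Proof.
  unfold Binomial.C; apply Rdiv_lt_0_compat; [|apply Rmult_lt_0_compat];
    apply INR_fact_lt_0.
Qed.

Lemma binomial_coef_sym (m k : nat) : (k <= m)%nat ->
  Binomial.C m (m - k) = Binomial.C m k.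
Proof. intros H; symmetry; apply pascal_step1; exact H. Qed.

(** Pascal's rule. Since [g] is arbitrary in both indices, one recursion serves both convolutions
    below; in each of them the bracket on the right collapses to a single product. *)
Lemma binomial_sum_succ (g : nat -> nat -> R) (n : nat) :
  sum_f_R0 (fun k => Binomial.C (S n) k * g k (S n - k)%nat) (S n) =
  sum_f_R0 (fun k => Binomial.C n k * (g k (S (n - k)) + g (S k) (n - k)%nat)) n.
Proof.
  assert (C0 : forall p, Binomial.C p 0 = 1).
  { intros p; unfold Binomial.C; rewrite Nat.sub_0_r; simpl; field; apply INR_fact_neq_0. }
  assert (Cn : forall p, Binomial.C p p = 1).
  { intros p; unfold Binomial.C; rewrite Nat.sub_diag; simpl; field; apply INR_fact_neq_0. }
  destruct n as [|n].
  - simpl; rewrite !C0, Cn; ring.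
  - rewrite (sum_eq (fun k => Binomial.C (S n) k * (g k (S (S n - k)) + g (S k) (S n - k)%nat))
      (fun k => Binomial.C (S n) k * g k (S (S n - k)) +
                Binomial.C (S n) k * g (S k) (S n - k)%nat)) by (intros; ring).
    rewrite plus_sum.
    rewrite (decomp_sum (fun k => Binomial.C (S n) k * g k (S (S n - k)))) by lia.
    rewrite (tech5 (fun k => Binomial.C (S n) k * g (S k) (S n - k)%nat) n).
    rewrite (tech5 _ (S n)), decomp_sum by lia.
    rewrite !C0, !Cn; simpl Nat.pred.
    rewrite (sum_eq (fun i => Binomial.C (S (S n)) (S i) * g (S i) (S (S n) - S i)%nat)
      (fun i => Binomial.C (S n) (S i) * g (S i) (S (S n - S i)) +
                Binomial.C (S n) i * g (S i) (S n - i)%nat)).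
    + rewrite plus_sum, !Nat.sub_diag, !Nat.sub_0_r; ring.
    + intros i Hi; rewrite <- pascal by lia.
      replace (S (S n - S i))%nat with (S n - i)%nat by lia.
      replace (S (S n) - S i)%nat with (S n - i)%nat by lia; ring.
Qed.

Lemma poch_vandermonde (a b : R) (n : nat) :
  sum_f_R0 (fun k => Binomial.C n k * (poch a k * poch b (n - k))) n =
  poch (a + b) n.
Proof.
  induction n as [|n IH].
  - unfold Binomial.C; simpl; field.
  - rewrite (binomial_sum_succ (fun k j => poch a k * poch b j)).
    simpl poch at 5; rewrite <- IH, Rmult_comm, scal_sum.
    apply sum_eq; intros i Hi; simpl; rewrite minus_INR by exact Hi; ring.
Qed.

(** Chu-Vandermonde for [2F1(-n, y; c; 1)], multiplied by [(c)_n]. The bracket produces the factor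
    [(c+k) - (y+k) = c - y] and moves [c] to [c + 1], so the induction runs over all [c]. *)
Lemma poch_alternating_sum (c y : R) (n : nat) :
  sum_f_R0 (fun k => Binomial.C n k *
    ((-1) ^ k * poch y k * poch (c + INR k) (n - k))) n = poch (c - y) n.
Proof.
  revert c; induction n as [|n IH]; intros c.
  - unfold Binomial.C; simpl; field.
  - rewrite (binomial_sum_succ (fun k j => (-1) ^ k * poch y k * poch (c + INR k) j)).
    rewrite poch_succ_l.
    replace (c - y + 1) with (c + 1 - y) by ring.
    rewrite <- IH, scal_sum.
    apply sum_eq; intros i Hi; rewrite poch_succ_l, S_INR; simpl.
    replace (c + 1 + INR i) with (c + INR i + 1) by ring.
    replace (c + (INR i + 1)) with (c + INR i + 1) by ring; ring.
Qed.

(** * Positivity of the Cauchy-product coefficients *)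

Definition sympoch (a b : R) (m k : nat) : R :=
  poch a k * poch b (m - k) + poch a (m - k) * poch b k.

(** Below the middle, both summands share the factor [(a)_k (b)_k]; what remains is a sum of two
    symbols of equal length [l], which can be compared between pairs of equal sum. *)
Lemma sympoch_factor (a b : R) (k l : nat) :
  sympoch a b (2 * k + l) k =
  poch a k * poch b k * (poch (a + INR k) l + poch (b + INR k) l).
Proof.
  unfold sympoch; replace (2 * k + l - k)%nat with (k + l)%nat by lia.
  rewrite !poch_add; ring.
Qed.

Lemma sympoch_sym (a b : R) (m k : nat) : (k <= m)%nat ->
  sympoch a b m (m - k) = sympoch a b m k.
Proof.
  intros H; unfold sympoch; replace (m - (m - k))%nat with k by lia; ring.
Qed.

(* Among pairs with a given sum, the ratio of consecutive symmetrised products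
   is larger for the more balanced pair [(A + d, B)]. *)
Lemma balanced_ratio_lt (A B d : R) (l : nat) : 0 <= A -> A < B -> 0 < d ->
  A * (B + d) * (poch (A + 1) l + poch (B + d + 1) l) *
    (poch (A + d) (S (S l)) + poch B (S (S l))) <
  (A + d) * B * (poch (A + d + 1) l + poch (B + 1) l) *
    (poch A (S (S l)) + poch (B + d) (S (S l))).
Proof.
  intros HA HAB Hd.
  assert (Hsplit : forall y, poch y (S (S l)) = y * (y + INR l + 1) * poch (y + 1) l).
  { intros y; rewrite poch_succ_l; simpl; ring. }
  rewrite !Hsplit.
  pose proof (pos_INR l) as Hl; set (L := INR l) in *.
  assert (0 < poch (A + 1) l) by (apply poch_pos; lra).
  assert (poch (A + 1) l <= poch (A + d + 1) l) by (apply poch_le; lra).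
  assert (poch (A + d + 1) l <= poch (B + d + 1) l) by (apply poch_le; lra).
  assert (poch (A + 1) l <= poch (B + 1) l) by (apply poch_le; lra).
  assert (poch (B + 1) l <= poch (B + d + 1) l) by (apply poch_le; lra).
  set (u0 := poch (A + 1) l) in *; set (u1 := poch (A + d + 1) l) in *.
  set (v1 := poch (B + 1) l) in *; set (v0 := poch (B + d + 1) l) in *.
  set (P := A * (A + L + 1) * u0 + (B + d) * (B + d + L + 1) * v0).
  set (Q := (A + d) * (A + d + L + 1) * u1 + B * (B + L + 1) * v1).
  assert (HP : 0 < P).
  { unfold P; assert (0 <= A * (A + L + 1) * u0) by (repeat apply Rmult_le_pos; lra).
    assert (0 < (B + d) * (B + d + L + 1) * v0) by (repeat apply Rmult_lt_0_compat; lra).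
    lra. }
  assert (HPQ : (u0 + v0) * Q <= (u1 + v1) * P).
  (* The coefficient of each product of two symbols is a difference of values of [y (y + L + 1)],
     hence contains the factor [d] or [B - A]. Each positive term then dominates the negative term
     it is grouped with. *)
  { assert (Hd2 : (u1 + v1) * P - (u0 + v0) * Q =
      d * ((2 * B + d + L + 1) * (v0 * v1) - (2 * A + d + L + 1) * (u0 * u1)) +
      (B - A) * ((A + B + 2 * d + L + 1) * (u1 * v0) - (A + B + L + 1) * (v1 * u0)))
      by (unfold P, Q; ring).
    assert (u0 * u1 <= v1 * v0) by (apply Rmult_le_compat; lra).
    assert (u0 * v1 <= u1 * v0) by (apply Rmult_le_compat; lra).
    assert (0 < u0 * u1) by (apply Rmult_lt_0_compat; lra).
    assert (0 < u0 * v1) by (apply Rmult_lt_0_compat; lra).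
    assert ((2 * A + d + L + 1) * (u0 * u1) <= (2 * B + d + L + 1) * (v1 * v0))
      by (apply Rmult_le_compat; lra).
    assert ((A + B + L + 1) * (u0 * v1) <= (A + B + 2 * d + L + 1) * (u1 * v0))
      by (apply Rmult_le_compat; lra).
    assert (0 <= d * ((2 * B + d + L + 1) * (v0 * v1) - (2 * A + d + L + 1) * (u0 * u1)))
      by (apply Rmult_le_pos; lra).
    assert (0 <= (B - A) * ((A + B + 2 * d + L + 1) * (u1 * v0) - (A + B + L + 1) * (v1 * u0)))
      by (apply Rmult_le_pos; lra).
    lra. }
  fold P; fold Q.
  assert (HAB' : A * (B + d) < (A + d) * B) by nra.
  assert (0 < (u1 + v1) * P) by (apply Rmult_lt_0_compat; lra).
  apply Rle_lt_trans with (A * (B + d) * ((u1 + v1) * P)).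
  - rewrite Rmult_assoc; apply Rmult_le_compat_l; [apply Rmult_le_pos; lra|exact HPQ].
  - rewrite (Rmult_assoc ((A + d) * B)); apply Rmult_lt_compat_r; assumption.
Qed.

(** [balanced_ratio_lt] at the shifted pair [a + k, b + k], multiplied by the split-off prefactors.
    Strictness is claimed only at [k = 0], because the prefactor [(a)_k] is zero when [a = 0] and
    [k >= 1]. *)
Lemma sympoch_step (a b d : R) (m k : nat) :
  0 <= a -> a < b -> 0 < d -> (2 * S k <= m)%nat ->
  sympoch (a + d) b m k * sympoch a (b + d) m (S k) <=
  sympoch (a + d) b m (S k) * sympoch a (b + d) m k /\
  (k = 0%nat -> sympoch (a + d) b m k * sympoch a (b + d) m (S k) <
     sympoch (a + d) b m (S k) * sympoch a (b + d) m k).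
Proof.
  intros Ha Hab Hd Hk.
  destruct (Nat.le_exists_sub (2 * S k) m Hk) as [l [Hl _]].
  assert (E1 : forall x y, sympoch x y m (S k) = poch x k * poch y k *
    ((x + INR k) * (y + INR k) * (poch (x + INR k + 1) l + poch (y + INR k + 1) l))).
  { intros x y; replace m with (2 * S k + l)%nat by lia; rewrite sympoch_factor.
    rewrite S_INR; simpl; rewrite <- !Rplus_assoc; ring. }
  assert (E0 : forall x y, sympoch x y m k = poch x k * poch y k *
    (poch (x + INR k) (S (S l)) + poch (y + INR k) (S (S l)))).
  { intros x y; replace m with (2 * k + S (S l))%nat by lia; apply sympoch_factor. }
  rewrite !E0, !E1.
  pose proof (pos_INR k).
  pose proof (balanced_ratio_lt (a + INR k) (b + INR k) d l
    ltac:(lra) ltac:(lra) Hd) as Hlt.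
  replace (a + d + INR k) with (a + INR k + d) by ring.
  replace (b + d + INR k) with (b + INR k + d) by ring.
  set (X := (a + INR k) * (b + INR k + d) * _) in *.
  set (Y := (a + INR k + d) * (b + INR k) * (_ + _)) in *.
  set (s := poch (a + INR k + d) (S (S l)) + _) in *.
  set (t := poch (a + INR k) (S (S l)) + _) in *.
  set (p := poch (a + d) k * poch b k); set (q := poch a k * poch (b + d) k).
  replace (p * s * (q * X)) with (p * q * (X * s)) by ring.
  replace (p * Y * (q * t)) with (p * q * (Y * t)) by ring.
  split.
  - apply Rmult_le_compat_l; [|lra].
    unfold p, q; repeat apply Rmult_le_pos; apply poch_nonneg; lra.
  - intros ->; apply Rmult_lt_compat_l; [|lra]; unfold p, q; simpl; lra.
Qed.

(** Transitivity of a comparison of ratios whose denominators may vanish: for [a = 0],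
    [sympoch a (b + d) m k] is zero at inner indices. The cancelled factor comes from the family
    [sympoch (a + d) b], which is always positive. *)
Lemma sympoch_chain (a b d : R) (m k l : nat) :
  0 <= a -> a < b -> 0 < d -> (l <= k)%nat -> (2 * k <= m)%nat ->
  sympoch (a + d) b m l * sympoch a (b + d) m k <=
  sympoch (a + d) b m k * sympoch a (b + d) m l.
Proof.
  intros Ha Hab Hd Hlk; induction Hlk as [|k Hlk IH]; intros Hm; [lra|].
  specialize (IH ltac:(lia)).
  destruct (sympoch_step a b d m k Ha Hab Hd ltac:(lia)) as [Hst _].
  assert (Hs : forall j, 0 < sympoch (a + d) b m j).
  { intros j; unfold sympoch.
    assert (forall i, 0 < poch (a + d) i) by (intros; apply poch_pos; lra).
    assert (forall i, 0 < poch b i) by (intros; apply poch_pos; lra).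
    apply Rplus_lt_0_compat; apply Rmult_lt_0_compat; auto. }
  pose proof (Hs k); pose proof (Hs l); pose proof (Hs (S k)).
  apply Rmult_le_reg_l with (sympoch (a + d) b m k); [lra|].
  apply Rle_trans with (sympoch (a + d) b m l *
    (sympoch (a + d) b m (S k) * sympoch a (b + d) m k)).
  - apply (Rmult_le_compat_l (sympoch (a + d) b m l)) in Hst; lra.
  - apply (Rmult_le_compat_l (sympoch (a + d) b m (S k))) in IH; lra.
Qed.

(** * Weights and coefficients of products of two Kummer functions *)

Definition cweight (c : R) (m k : nat) : R := / (poch c k * poch c (m - k)).

Lemma cweight_pos (c : R) (m k : nat) : 0 < c -> 0 < cweight c m k.
Proof.
  intros Hc; apply Rinv_0_lt_compat, Rmult_lt_0_compat; apply poch_pos, Hc.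
Qed.

Lemma cweight_sym (c : R) (m k : nat) : (k <= m)%nat ->
  cweight c m (m - k) = cweight c m k.
Proof.
  intros H; unfold cweight; replace (m - (m - k))%nat with k by lia.
  f_equal; ring.
Qed.

Lemma cweight_step (c : R) (m k : nat) : 0 < c -> (2 * S k <= m)%nat ->
  cweight c m k < cweight c m (S k).
Proof.
  intros Hc Hk; unfold cweight.
  pose proof (poch_pos c k Hc) as H1; pose proof (poch_pos c (m - S k) Hc) as H2.
  pose proof (poch_pos c (S k) Hc) as H3.
  apply Rinv_lt_contravar.
  { apply Rmult_lt_0_compat; apply Rmult_lt_0_compat; auto; apply poch_pos, Hc. }
  replace (m - k)%nat with (S (m - S k)) by lia; simpl.
  assert (INR k < INR (m - S k)) by (apply lt_INR; lia).
  assert (0 < poch c k * poch c (m - S k)) by (apply Rmult_lt_0_compat; auto).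
  nra.
Qed.

Lemma cweight_chain (c : R) (m k l : nat) : 0 < c -> (l <= k)%nat ->
  (2 * k <= m)%nat -> cweight c m l <= cweight c m k.
Proof.
  intros Hc Hlk; induction Hlk as [|k Hlk IH]; intros Hm; [lra|].
  pose proof (cweight_step c m k Hc ltac:(lia)); specialize (IH ltac:(lia)); lra.
Qed.

(** This is [m!] times the coefficient of [x^m] in [F11 a c x * F11 b c x]. *)
Definition cauchy_coef (c a b : R) (m : nat) : R :=
  sum_f_R0 (fun k => Binomial.C m k * cweight c m k * (poch a k * poch b (m - k))) m.

Lemma cauchy_coef_comm (c a b : R) (m : nat) :
  cauchy_coef c a b m = cauchy_coef c b a m.
Proof.
  unfold cauchy_coef; rewrite <- sum_f_R0_skip; apply sum_eq; intros k Hk.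
  rewrite binomial_coef_sym, cweight_sym by exact Hk.
  replace (m - (m - k))%nat with k by lia; ring.
Qed.

Lemma cauchy_coef_symmetrize (c a b : R) (m : nat) :
  2 * cauchy_coef c a b m =
  sum_f_R0 (fun k => cweight c m k * (Binomial.C m k * sympoch a b m k)) m.
Proof.
  unfold cauchy_coef; rewrite sum_f_R0_symmetrize; apply sum_eq; intros k Hk.
  rewrite binomial_coef_sym, cweight_sym by exact Hk; unfold sympoch.
  replace (m - (m - k))%nat with k by lia; ring.
Qed.

Lemma sympoch_sum (a b : R) (m : nat) :
  sum_f_R0 (fun k => Binomial.C m k * sympoch a b m k) m = 2 * poch (a + b) m.
Proof.
  rewrite <- poch_vandermonde, sum_f_R0_symmetrize; apply sum_eq; intros k Hk.
  rewrite binomial_coef_sym by exact Hk; unfold sympoch.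
  replace (m - (m - k))%nat with k by lia; ring.
Qed.

(** Chebyshev's hypothesis concerns all pairs of indices up to [m], whereas monotonicity is known
    only up to [m/2]. A single witness, [min(k, m-k)], must serve all the symmetric quantities at
    once. *)
Lemma half_range_representative (m k : nat) : (k <= m)%nat ->
  exists k', (2 * k' <= m)%nat /\
    (forall c, cweight c m k = cweight c m k') /\
    (forall a b, sympoch a b m k = sympoch a b m k') /\
    Binomial.C m k = Binomial.C m k'.
Proof.
  intros Hk; destruct (Nat.le_gt_cases (2 * k) m) as [H|H].
  - exists k; auto.
  - exists (m - k)%nat; split; [lia|]; repeat split; intros.
    + symmetry; apply cweight_sym; lia.
    + symmetry; apply sympoch_sym; lia.
    + symmetry; apply binomial_coef_sym; lia.
Qed.

Lemma cauchy_coef_balanced_lt (a b c d : R) (m : nat) :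
  0 <= a -> a < b -> 0 < c -> 0 < d -> (2 <= m)%nat ->
  cauchy_coef c a (b + d) m < cauchy_coef c (a + d) b m.
Proof.
  intros Ha Hab Hc Hd Hm.
  enough (2 * cauchy_coef c a (b + d) m < 2 * cauchy_coef c (a + d) b m) by lra.
  rewrite !cauchy_coef_symmetrize.
  (* By Vandermonde this is the unweighted total of both families. Multiplying by it, and reading it
     as one family's sum on the left and the other's on the right, gives the shape of Chebyshev's
     inequality. *)
  assert (HS : 0 < 2 * poch (a + d + b) m)
    by (pose proof (poch_pos (a + d + b) m ltac:(lra)); lra).
  apply Rmult_lt_reg_r with (2 * poch (a + d + b) m); [exact HS|].
  rewrite <- (sympoch_sum (a + d) b m) at 1.
  replace (a + d + b) with (a + (b + d)) by ring.
  rewrite <- (sympoch_sum a (b + d) m).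
  apply (chebyshev_sum_lt (cweight c m)
    (fun k => Binomial.C m k * sympoch (a + d) b m k)
    (fun k => Binomial.C m k * sympoch a (b + d) m k) m 1 0); try lia.
  - intros k l Hk Hl.
    destruct (half_range_representative m k Hk) as [k' [Hk' [-> [Ek ->]]]].
    destruct (half_range_representative m l Hl) as [l' [Hl' [-> [El ->]]]].
    rewrite !Ek, !El.
    pose proof (binomial_coef_pos m k'); pose proof (binomial_coef_pos m l').
    assert (0 < Binomial.C m k' * Binomial.C m l') by (apply Rmult_lt_0_compat; auto).
    set (p := Binomial.C m k') in *; set (q := Binomial.C m l') in *.
    destruct (Nat.le_ge_cases l' k') as [Hlk|Hlk].
    + pose proof (cweight_chain c m k' l' Hc Hlk Hk').
      pose proof (sympoch_chain a b d m k' l' Ha Hab Hd Hlk Hk') as Hch.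
      set (x := sympoch (a + d) b m k') in *; set (y := sympoch a (b + d) m l') in *.
      set (x' := sympoch (a + d) b m l') in *; set (y' := sympoch a (b + d) m k') in *.
      replace (p * x * (q * y) - p * y' * (q * x'))
        with (p * q * (x * y - x' * y')) by ring.
      apply Rmult_le_pos; [lra|]; apply Rmult_le_pos; lra.
    + pose proof (cweight_chain c m l' k' Hc Hlk Hl').
      pose proof (sympoch_chain a b d m l' k' Ha Hab Hd Hlk Hl') as Hch.
      set (x := sympoch (a + d) b m k') in *; set (y := sympoch a (b + d) m l') in *.
      set (x' := sympoch (a + d) b m l') in *; set (y' := sympoch a (b + d) m k') in *.
      rewrite <- Rmult_opp_opp.
      replace (- (p * x * (q * y) - p * y' * (q * x')))
        with (p * q * (x' * y' - x * y)) by ring.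
      apply Rmult_le_pos; [lra|]; apply Rmult_le_pos; lra.
  - pose proof (cweight_step c m 0 Hc ltac:(lia)).
    destruct (sympoch_step a b d m 0 Ha Hab Hd ltac:(lia)) as [_ Hst].
    specialize (Hst eq_refl).
    pose proof (binomial_coef_pos m 1); pose proof (binomial_coef_pos m 0).
    set (p := Binomial.C m 1) in *; set (q := Binomial.C m 0) in *.
    set (x := sympoch (a + d) b m 1) in *; set (y := sympoch a (b + d) m 0) in *.
    set (x' := sympoch (a + d) b m 0) in *; set (y' := sympoch a (b + d) m 1) in *.
    apply Rmult_lt_0_compat; [lra|].
    replace (p * x * (q * y) - p * y' * (q * x'))
      with (p * q * (x * y - x' * y')) by ring.
    apply Rmult_lt_0_compat; [apply Rmult_lt_0_compat; auto|lra].
Qed.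

(** After folding, positivity holds term by term: the hypothesis on [L] compares the prefactors at
    [k <= m/2], and [poch_supermodular] compares the remaining sums. *)
Lemma cauchy_coef_lower (a b c d L : R) (m : nat) :
  0 < a -> a < b -> 0 < c -> 0 < d -> 0 <= L ->
  (forall k, L * (poch (a + d) k * poch b k) < poch a k * poch (b + d) k) ->
  L * cauchy_coef c (a + d) b m < cauchy_coef c a (b + d) m.
Proof.
  intros Ha Hab Hc Hd HL0 HL.
  enough (0 < 2 * cauchy_coef c a (b + d) m - L * (2 * cauchy_coef c (a + d) b m)) by lra.
  rewrite !cauchy_coef_symmetrize, scal_sum, <- minus_sum.
  assert (Hterm : forall k, (k <= m)%nat ->
    0 < cweight c m k * (Binomial.C m k * sympoch a (b + d) m k)
        - cweight c m k * (Binomial.C m k * sympoch (a + d) b m k) * L).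
  { intros k Hk; destruct (half_range_representative m k Hk) as [k' [Hk' [-> [E ->]]]].
    rewrite !E; clear E.
    pose proof (cweight_pos c m k' Hc); pose proof (binomial_coef_pos m k').
    replace (cweight c m k' * (Binomial.C m k' * sympoch a (b + d) m k')
      - cweight c m k' * (Binomial.C m k' * sympoch (a + d) b m k') * L)
      with (cweight c m k' * Binomial.C m k' *
        (sympoch a (b + d) m k' - L * sympoch (a + d) b m k')) by ring.
    apply Rmult_lt_0_compat; [apply Rmult_lt_0_compat; auto|].
    destruct (Nat.le_exists_sub (2 * k') m Hk') as [l [Hl _]].
    replace m with (2 * k' + l)%nat by lia; rewrite !sympoch_factor.
    pose proof (pos_INR k').
    pose proof (poch_supermodular (a + INR k') (b + INR k') d l
      ltac:(lra) ltac:(lra) ltac:(lra)) as Hsup.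
    replace (a + d + INR k') with (a + INR k' + d) by ring.
    replace (b + d + INR k') with (b + INR k' + d) by ring.
    specialize (HL k').
    assert (0 < poch (a + INR k' + d) l) by (apply poch_pos; lra).
    assert (0 < poch (b + INR k') l) by (apply poch_pos; lra).
    assert (0 < poch (a + d) k' * poch b k')
      by (apply Rmult_lt_0_compat; apply poch_pos; lra).
    set (u := poch (a + INR k' + d) l + poch (b + INR k') l).
    set (v := poch (a + INR k') l + poch (b + INR k' + d) l).
    assert (0 < u <= v) by (unfold u, v; lra).
    assert (0 <= L * (poch (a + d) k' * poch b k')) by (apply Rmult_le_pos; lra).
    set (p := poch (a + d) k' * poch b k') in *.
    set (q := poch a k' * poch (b + d) k') in *.
    nra. }
  apply sum_f_R0_pos_one with 0%nat; [lia| |apply Hterm; lia].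
  intros i Hi; apply Rlt_le, Hterm, Hi.
Qed.

(** * The Kummer function *)

Definition F11_term (a c x : R) (k : nat) : R :=
  poch a k / poch c k * x ^ k / INR (fact k).

Lemma is_series_partial_le (u : nat -> R) (l : R) (n : nat) :
  (forall k, 0 <= u k) -> is_series u l -> sum_f_R0 u n <= l.
Proof.
  intros Hu Hl; rewrite <- sum_n_Reals.
  apply (is_lim_seq_incr_compare (sum_n u)); [exact Hl|].
  intros k; rewrite sum_Sn; change (sum_n u k <= sum_n u k + u (S k)).
  specialize (Hu (S k)); lra.
Qed.

Lemma is_series_pos (u : nat -> R) (l : R) (n : nat) :
  (forall k, 0 <= u k) -> 0 < u n -> is_series u l -> 0 < l.
Proof.
  intros Hu Hn Hl; apply Rlt_le_trans with (sum_f_R0 u n).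
  - apply sum_f_R0_pos_one with n; auto.
  - apply is_series_partial_le; assumption.
Qed.

Lemma is_series_exp (x : R) : is_series (fun k => x ^ k / INR (fact k)) (exp x).
Proof.
  apply is_series_ext with (2 := is_exp_Reals x).
  intros k; rewrite pow_n_pow; unfold scal; simpl; unfold mult; simpl.
  unfold Rdiv; ring.
Qed.

Lemma ex_series_exp_Rabs (x : R) : ex_series (fun k => Rabs (x ^ k / INR (fact k))).
Proof.
  exists (exp (Rabs x)); apply is_series_ext with (2 := is_series_exp (Rabs x)).
  intros k; unfold Rdiv; rewrite Rabs_mult, <- RPow_abs.
  rewrite (Rabs_pos_eq (/ _)); [reflexivity|].
  apply Rlt_le, Rinv_0_lt_compat, INR_fact_lt_0.
Qed.

(** Each factor satisfies [|a + j| / (c + j) <= |a| / c + 1], so the Kummer series is dominated by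
    an exponential series. The bound covers [a] of either sign, as the range [(-oo, c - d]] in (b)
    requires. *)
Lemma poch_ratio_bound (a c : R) (k : nat) : 0 < c ->
  Rabs (poch a k / poch c k) <= (Rabs a / c + 1) ^ k.
Proof.
  intros Hc; induction k as [|k IH].
  - simpl; rewrite Rdiv_1_r, Rabs_R1; lra.
  - pose proof (poch_pos c k Hc); pose proof (pos_INR k).
    replace (poch a (S k) / poch c (S k))
      with ((a + INR k) / (c + INR k) * (poch a k / poch c k)) by (simpl; field; lra).
    rewrite Rabs_mult; simpl pow.
    apply Rmult_le_compat; try apply Rabs_pos; [|exact IH].
    unfold Rdiv; rewrite Rabs_mult, (Rabs_pos_eq (/ _))
      by (apply Rlt_le, Rinv_0_lt_compat; lra).
    apply Rmult_le_reg_r with (c + INR k); [lra|].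
    rewrite Rmult_assoc, Rinv_l, Rmult_1_r by lra.
    replace ((Rabs a * / c + 1) * (c + INR k))
      with (Rabs a + c + INR k + Rabs a * / c * INR k) by (field; lra).
    pose proof (Rabs_triang a (INR k)) as Ht; rewrite (Rabs_pos_eq (INR k)) in Ht by auto.
    assert (0 <= Rabs a * / c * INR k).
    { repeat apply Rmult_le_pos; auto; [apply Rabs_pos|].
      apply Rlt_le, Rinv_0_lt_compat; lra. }
    lra.
Qed.

Lemma ex_series_F11_Rabs (a c x : R) : 0 < c ->
  ex_series (fun k => Rabs (F11_term a c x k)).
Proof.
  intros Hc.
  apply (@ex_series_le R_AbsRing R_CompleteNormedModule)
    with (fun k => Rabs (((Rabs a / c + 1) * x) ^ k / INR (fact k)));
    [|apply ex_series_exp_Rabs].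
  intros k; unfold norm; simpl; unfold abs; simpl; rewrite Rabs_Rabsolu.
  unfold F11_term, Rdiv; rewrite !Rabs_mult, Rpow_mult_distr, Rabs_mult.
  apply Rmult_le_compat_r; [apply Rabs_pos|].
  apply Rmult_le_compat_r; [apply Rabs_pos|].
  rewrite <- Rabs_mult.
  apply Rle_trans with (1 := poch_ratio_bound a c k Hc); apply Rle_abs.
Qed.

Lemma is_series_F11 (a c x : R) : 0 < c -> is_series (F11_term a c x) (F11 a c x).
Proof.
  intros Hc; apply Series_correct, ex_series_Rabs, ex_series_F11_Rabs, Hc.
Qed.

Lemma is_series_F11_mult (a b c x : R) : 0 < c ->
  is_series (fun m => cauchy_coef c a b m / INR (fact m) * x ^ m)
    (F11 a c x * F11 b c x).
Proof.
  intros Hc.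
  apply is_series_ext with (2 := is_series_mult _ _ _ _
    (is_series_F11 a c x Hc) (is_series_F11 b c x Hc)
    (ex_series_F11_Rabs a c x Hc) (ex_series_F11_Rabs b c x Hc)).
  intros m; unfold cauchy_coef, Rdiv; rewrite Rmult_assoc, Rmult_comm, scal_sum.
  apply sum_eq; intros k Hk; unfold F11_term, Binomial.C, cweight.
  replace (x ^ m) with (x ^ k * x ^ (m - k)) by (rewrite <- pow_add; f_equal; lia).
  pose proof (poch_pos c k Hc); pose proof (poch_pos c (m - k) Hc).
  field; repeat split; try apply INR_fact_neq_0; lra.
Qed.

Lemma F11_term_nonneg (a c x : R) (k : nat) : 0 <= a -> 0 < c -> 0 <= x ->
  0 <= F11_term a c x k.
Proof.
  intros Ha Hc Hx; unfold F11_term, Rdiv.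
  repeat apply Rmult_le_pos.
  - apply poch_nonneg, Ha.
  - apply Rlt_le, Rinv_0_lt_compat, poch_pos, Hc.
  - apply pow_le, Hx.
  - apply Rlt_le, Rinv_0_lt_compat, INR_fact_lt_0.
Qed.

Lemma F11_term_0 (a c x : R) : F11_term a c x 0 = 1.
Proof. unfold F11_term; simpl; field. Qed.

Lemma F11_pos (a c x : R) : 0 <= a -> 0 < c -> 0 <= x -> 0 < F11 a c x.
Proof.
  intros Ha Hc Hx; apply is_series_pos with (F11_term a c x) 0%nat.
  - intros; apply F11_term_nonneg; assumption.
  - rewrite F11_term_0; lra.
  - apply is_series_F11, Hc.
Qed.

Lemma F11_at_0 (a c : R) : 0 < c -> F11 a c 0 = 1.
Proof.
  intros Hc; unfold F11; rewrite Series_incr_1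
    by (apply ex_series_Rabs, (ex_series_F11_Rabs a c 0 Hc)).
  rewrite (Series_ext _ (fun k => 0 * 0)) by (intros; simpl; unfold Rdiv; ring).
  rewrite Series_scal_l; simpl; field.
Qed.

(** The Cauchy product of the two series on the right; its coefficients are evaluated by
    [poch_alternating_sum] with [y = c - a]. *)
Lemma kummer_transformation (a c x : R) : 0 < c ->
  F11 a c x = exp x * F11 (c - a) c (- x).
Proof.
  intros Hc; rewrite Rmult_comm; apply is_series_unique.
  apply is_series_ext with (2 := is_series_mult _ _ _ _
    (is_series_F11 (c - a) c (- x) Hc) (is_series_exp x)
    (ex_series_F11_Rabs (c - a) c (- x) Hc) (ex_series_exp_Rabs x)).
  intros n.
  replace (poch a n) with (poch (c - (c - a)) n) by (f_equal; ring).
  rewrite <- poch_alternating_sum.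
  replace (sum_f_R0 _ n / poch c n * x ^ n / INR (fact n)) with
    (x ^ n / (poch c n * INR (fact n)) * sum_f_R0 (fun k => Binomial.C n k *
      ((-1) ^ k * poch (c - a) k * poch (c + INR k) (n - k))) n)
    by (field; split; [apply Rgt_not_eq, poch_pos, Hc|apply INR_fact_neq_0]).
  rewrite scal_sum; apply sum_eq; intros k Hk; unfold F11_term, Binomial.C.
  replace (x ^ n) with (x ^ k * x ^ (n - k)) by (rewrite <- pow_add; f_equal; lia).
  replace (poch c n) with (poch c k * poch (c + INR k) (n - k))
    by (rewrite <- poch_add; f_equal; lia).
  replace ((- x) ^ k) with ((-1) ^ k * x ^ k)
    by (rewrite <- Rpow_mult_distr; f_equal; ring).
  pose proof (poch_pos c k Hc); pose proof (pos_INR k).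
  pose proof (poch_pos (c + INR k) (n - k) ltac:(lra)).
  field; repeat split; try apply INR_fact_neq_0; lra.
Qed.

Lemma is_series_turan (a b c d x : R) : 0 < c ->
  is_series (fun m => (cauchy_coef c (a + d) b m - cauchy_coef c a (b + d) m)
                        / INR (fact m) * x ^ m)
    (F11 (a + d) c x * F11 b c x - F11 (b + d) c x * F11 a c x).
Proof.
  intros Hc; rewrite (Rmult_comm (F11 (b + d) c x)).
  apply is_series_ext with (2 := is_series_minus _ _ _ _
    (is_series_F11_mult (a + d) b c x Hc) (is_series_F11_mult a (b + d) c x Hc)).
  intros m; unfold plus, opp, minus, Rdiv; simpl.
  unfold plus, opp; simpl; ring.
Qed.

(** In degrees 0 and 1 the coefficient of a product depends only on the sum of its two upper
    parameters, here [a + b + d] for both products. *)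
Lemma turan_coef_vanish (a b c d : R) (m : nat) : 0 < c -> (m < 2)%nat ->
  cauchy_coef c (a + d) b m - cauchy_coef c a (b + d) m = 0.
Proof.
  intros Hc Hm; unfold cauchy_coef, cweight, Binomial.C.
  destruct m as [|[|m]]; [| |lia]; simpl; field; lra.
Qed.

Lemma turan_coef_pos (a b c d : R) (m : nat) :
  0 <= a -> a < b -> 0 < c -> 0 < d -> (2 <= m)%nat ->
  0 < (cauchy_coef c (a + d) b m - cauchy_coef c a (b + d) m) / INR (fact m).
Proof.
  intros; apply Rdiv_lt_0_compat; [|apply INR_fact_lt_0].
  apply Rlt_0_minus, cauchy_coef_balanced_lt; assumption.
Qed.

Lemma F11_turan (a b c d x : R) : 0 <= a -> a < b -> 0 < c -> 0 < d -> 0 < x ->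
  F11 (b + d) c x * F11 a c x < F11 (a + d) c x * F11 b c x.
Proof.
  intros Ha Hab Hc Hd Hx; apply Rlt_0_minus.
  apply is_series_pos with (3 := is_series_turan a b c d x Hc) (n := 2%nat).
  - intros k; destruct (Nat.le_gt_cases 2 k) as [Hk|Hk].
    + apply Rmult_le_pos; [|apply pow_le; lra].
      apply Rlt_le, turan_coef_pos; assumption.
    + rewrite turan_coef_vanish by assumption; unfold Rdiv; rewrite !Rmult_0_l; lra.
  - apply Rmult_lt_0_compat; [|apply pow_lt, Hx].
    apply turan_coef_pos; auto.
Qed.

Lemma F11_turan_le (a b c d x : R) : 0 <= a -> a <= b -> 0 < c -> 0 < d -> 0 < x ->
  F11 (b + d) c x * F11 a c x <= F11 (a + d) c x * F11 b c x.
Proof.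
  intros Ha [Hab| ->] Hc Hd Hx; [|lra].
  apply Rlt_le, F11_turan; assumption.
Qed.

Lemma F11_turan_lower (a b c d L x : R) :
  0 < a -> a < b -> 0 < c -> 0 < d -> 0 <= L -> 0 < x ->
  (forall k, L * (poch (a + d) k * poch b k) < poch a k * poch (b + d) k) ->
  L * (F11 (a + d) c x * F11 b c x) < F11 (b + d) c x * F11 a c x.
Proof.
  intros Ha Hab Hc Hd HL Hx HLk; rewrite (Rmult_comm (F11 (b + d) c x)).
  apply Rlt_0_minus.
  assert (Hpos : forall m, 0 < (cauchy_coef c a (b + d) m / INR (fact m) * x ^ m)
    - L * (cauchy_coef c (a + d) b m / INR (fact m) * x ^ m)).
  { intros m; pose proof (cauchy_coef_lower a b c d L m Ha Hab Hc Hd HL HLk).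
    replace (_ - _) with ((cauchy_coef c a (b + d) m - L * cauchy_coef c (a + d) b m)
      / INR (fact m) * x ^ m) by (field; apply INR_fact_neq_0).
    apply Rmult_lt_0_compat; [|apply pow_lt, Hx].
    apply Rdiv_lt_0_compat; [lra|apply INR_fact_lt_0]. }
  eapply (is_series_pos (fun m => (cauchy_coef c a (b + d) m / INR (fact m) * x ^ m)
    - L * (cauchy_coef c (a + d) b m / INR (fact m) * x ^ m)) _ 0%nat).
  - intros k; apply Rlt_le, Hpos.
  - apply Hpos.
  - apply (is_series_minus _ _ _ _ (is_series_F11_mult a (b + d) c x Hc)
      (is_series_scal L _ _ (is_series_F11_mult (a + d) b c x Hc))).
Qed.

(** * Behaviour at infinity *)

(* With [f_k] the coefficients, [(k + 1) f_(k+1) = f_k (a + k) / (c + k)], and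
   [f_k / (c + k) <= (1 + 1 / a) f_(k+1)]; so the derivative of [F11 a c] differs
   from [F11 a c] by at most [O (F11 a c x / x)]. *)
Lemma F11_contiguous_bound (a c x : R) : 0 < a -> 0 < c -> 0 < x ->
  Rabs (a * F11 (a + 1) c x - x * F11 a c x) <=
  (a + Rabs (a - c) * (1 + / a)) * F11 a c x.
Proof.
  intros Ha Hc Hx.
  set (K := Rabs (a - c) * (1 + / a)).
  assert (Hnn : forall k, 0 <= F11_term a c x k) by (intros; apply F11_term_nonneg; lra).
  assert (Hinva : 0 < / a) by (apply Rinv_0_lt_compat, Ha).
  assert (HK : 0 <= K) by (apply Rmult_le_pos; [apply Rabs_pos|lra]).
  pose proof (F11_pos a c x ltac:(lra) Hc ltac:(lra)) as HF.
  pose proof (is_series_F11 a c x Hc) as SF.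
  pose proof (is_series_F11 (a + 1) c x Hc) as SF1.
  (* This is the series of [x] times the derivative of [F11 a c], obtained from
     [a (a+1)_k = (a)_k (a+k)]. *)
  assert (Hinc : is_series (fun k => INR k * F11_term a c x k)
    (a * F11 (a + 1) c x - a * F11 a c x)).
  { apply is_series_ext with (2 := is_series_minus _ _ _ _
      (is_series_scal a _ _ SF1) (is_series_scal a _ _ SF)).
    intros k; unfold plus, opp, scal; simpl; unfold mult; simpl.
    unfold F11_term, Rdiv.
    replace (a * (poch (a + 1) k * / poch c k * x ^ k * / INR (fact k))) with
      (a * poch (a + 1) k * (/ poch c k * x ^ k * / INR (fact k))) by ring.
    rewrite poch_shift; ring. }
  assert (Hder : is_series (fun k => INR (S k) * F11_term a c x (S k))
    (a * F11 (a + 1) c x - a * F11 a c x)).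
  { replace (a * F11 (a + 1) c x - a * F11 a c x) with
      (plus (a * F11 (a + 1) c x - a * F11 a c x) (opp (INR 0 * F11_term a c x 0)))
      by (unfold plus, opp; simpl; ring).
    apply (is_series_incr_1 (fun k => INR k * F11_term a c x k)).
    unfold plus, opp; simpl.
    replace (_ + 0 * _) with (a * F11 (a + 1) c x - a * F11 a c x)
      by (simpl; ring).
    exact Hinc. }
  assert (Hdiff : is_series
    (fun k => INR (S k) * F11_term a c x (S k) - x * F11_term a c x k)
    (a * F11 (a + 1) c x - a * F11 a c x - x * F11 a c x)).
  { apply (is_series_minus _ _ _ _ Hder (is_series_scal x _ _ SF)). }
  assert (Hbnd : forall k,
    Rabs (INR (S k) * F11_term a c x (S k) - x * F11_term a c x k)
      <= K * F11_term a c x (S k)).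
  { intros k; pose proof (pos_INR k).
    assert (Hrec : x * F11_term a c x k =
      (c + INR k) * (INR k + 1) / (a + INR k) * F11_term a c x (S k)).
    { unfold F11_term; change (fact (S k)) with (S k * fact k)%nat.
      rewrite mult_INR, S_INR; simpl.
      pose proof (poch_pos c k Hc); field.
      repeat split; try apply INR_fact_neq_0; lra. }
    rewrite Hrec, S_INR.
    replace ((INR k + 1) * F11_term a c x (S k) -
      (c + INR k) * (INR k + 1) / (a + INR k) * F11_term a c x (S k))
      with ((a - c) * ((INR k + 1) / (a + INR k)) * F11_term a c x (S k))
      by (field; lra).
    assert (Hq : 0 <= (INR k + 1) / (a + INR k) <= 1 + / a).
    { split.
      - apply Rlt_le, Rdiv_lt_0_compat; lra.
      - apply Rmult_le_reg_r with (a + INR k); [lra|].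
        unfold Rdiv; rewrite Rmult_assoc, Rinv_l, Rmult_1_r by lra.
        replace ((1 + / a) * (a + INR k)) with (a + INR k + 1 + INR k * / a)
          by (field; lra).
        assert (0 <= INR k * / a) by (apply Rmult_le_pos; lra); lra. }
    rewrite !Rabs_mult, (Rabs_pos_eq (F11_term _ _ _ _)) by apply Hnn.
    rewrite (Rabs_pos_eq (_ / _)) by apply Hq.
    apply Rmult_le_compat_r; [apply Hnn|].
    apply Rmult_le_compat_l; [apply Rabs_pos|apply Hq]. }
  assert (Htail : is_series (fun k => F11_term a c x (S k)) (F11 a c x - 1)).
  { replace (F11 a c x - 1) with (plus (F11 a c x) (opp (F11_term a c x 0)))
      by (rewrite F11_term_0; reflexivity).
    apply (is_series_incr_1 (F11_term a c x)).
    unfold plus, opp; simpl.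
    replace (_ + F11_term a c x 0) with (F11 a c x) by ring; exact SF. }
  assert (Hsum : Rabs (a * F11 (a + 1) c x - a * F11 a c x - x * F11 a c x)
    <= K * (F11 a c x - 1)).
  { rewrite <- (is_series_unique _ _ Hdiff).
    rewrite <- (is_series_unique _ _ Htail), <- Series_scal_l.
    apply Rle_trans with (Series (fun k =>
      Rabs (INR (S k) * F11_term a c x (S k) - x * F11_term a c x k))).
    - apply Series_Rabs.
      apply (@ex_series_le R_AbsRing R_CompleteNormedModule)
        with (fun k => K * F11_term a c x (S k)).
      + intros k; unfold norm; simpl; unfold abs; simpl; rewrite Rabs_Rabsolu; apply Hbnd.
      + exists (K * (F11 a c x - 1)); apply (is_series_scal K _ _ Htail).
    - apply Series_le.
      + intros k; split; [apply Rabs_pos|apply Hbnd].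
      + exists (K * (F11 a c x - 1)); apply (is_series_scal K _ _ Htail). }
  replace (a * F11 (a + 1) c x - x * F11 a c x) with
    (a * F11 a c x + (a * F11 (a + 1) c x - a * F11 a c x - x * F11 a c x)) by ring.
  apply Rle_trans with (1 := Rabs_triang _ _).
  rewrite (Rabs_pos_eq (a * F11 a c x)) by (apply Rmult_le_pos; lra).
  lra.
Qed.

Lemma F11_contiguous_lim (a c : R) : 0 < a -> 0 < c ->
  is_lim (fun x => a * F11 (a + 1) c x / (x * F11 a c x)) p_infty 1.
Proof.
  intros Ha Hc; set (M := a + Rabs (a - c) * (1 + / a)).
  assert (Hz : forall s, is_lim (fun x => 1 + s * / x) p_infty 1).
  { intros s; replace (Finite 1) with (Finite (1 + s * 0)) by (f_equal; ring).
    apply is_lim_plus'; [apply is_lim_const|].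
    apply (is_lim_scal_l (fun x => / x) s p_infty 0).
    apply (is_lim_inv (fun x => x) p_infty p_infty); [apply is_lim_id|discriminate]. }
  apply is_lim_le_le_loc with (fun x => 1 + (- M) * / x) (fun x => 1 + M * / x);
    [|apply Hz|apply Hz].
  exists 0; intros x Hx.
  pose proof (F11_pos a c x ltac:(lra) Hc ltac:(lra)) as HF.
  pose proof (F11_contiguous_bound a c x Ha Hc Hx) as Hb; fold M in Hb.
  apply Rabs_le_between in Hb.
  assert (0 < x * F11 a c x) by (apply Rmult_lt_0_compat; lra).
  split; apply Rmult_le_reg_r with (x * F11 a c x); auto;
    unfold Rdiv; rewrite (Rmult_assoc (a * _)), Rinv_l, Rmult_1_r by lra.
  - replace ((1 + - M * / x) * (x * F11 a c x)) with (x * F11 a c x - M * F11 a c x)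
      by (field; lra); lra.
  - replace ((1 + M * / x) * (x * F11 a c x)) with (x * F11 a c x + M * F11 a c x)
      by (field; lra); lra.
Qed.

(** * The Gamma function *)

Lemma filter_prod_positive_axis (P : R -> R -> Prop) :
  (forall u v, 0 < u -> u < v -> P u v) ->
  filter_prod (at_right 0) (Rbar_locally p_infty) (fun ab => P (fst ab) (snd ab)).
Proof.
  intros HP; apply Filter_prod with (fun u => 0 < u < 1) (fun v => 1 < v).
  - exists (mkposreal 1 Rlt_0_1); intros u Hu Hu0; split; [exact Hu0|].
    unfold ball in Hu; simpl in Hu; unfold AbsRing_ball, abs, minus, plus, opp in Hu.
    simpl in Hu; apply Rabs_def2 in Hu; lra.
  - exists 1; auto.
  - intros u v [Hu0 Hu1] Hv; apply HP; simpl in *; lra.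
Qed.

Lemma is_RInt_gen_nonneg (f : R -> R) (l : R) : (forall t, 0 < t -> 0 <= f t) ->
  is_RInt_gen f (at_right 0) (Rbar_locally p_infty) l -> 0 <= l.
Proof.
  intros Hf Hl; apply Rle_trans with (norm l); [apply norm_ge_0|].
  apply (@RInt_gen_norm R_CompleteNormedModule (at_right 0) (Rbar_locally p_infty) _ _
    f f l l); auto.
  - apply (filter_prod_positive_axis (fun u v => u <= v)); intros; lra.
  - apply (filter_prod_positive_axis (fun u v => forall x, u <= x <= v -> norm (f x) <= f x)).
    intros u v Hu Huv x Hx; unfold norm; simpl; unfold abs; simpl.
    rewrite Rabs_pos_eq; [lra|apply Hf; lra].
Qed.

(** Integrals of a nonnegative function grow with the interval, so their supremum is the improper
    integral. The second conclusion later yields positivity of [Gamma] from the integral over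
    [[1, 2]]. *)
Lemma is_RInt_gen_bounded (f : R -> R) (M : R) :
  (forall t, 0 < t -> continuous f t) -> (forall t, 0 < t -> 0 <= f t) ->
  (forall u v, 0 < u -> u <= v -> RInt f u v <= M) ->
  exists l, is_RInt_gen f (at_right 0) (Rbar_locally p_infty) l /\
    forall u v, 0 < u -> u <= v -> RInt f u v <= l.
Proof.
  intros Hc Hf HM.
  assert (Hex : forall u v, 0 < u -> u <= v -> ex_RInt f u v).
  { intros u v Hu Huv; apply (@ex_RInt_continuous R_CompleteNormedModule).
    intros z; rewrite Rmin_left, Rmax_right by lra; intros Hz; apply Hc; lra. }
  assert (Hge : forall u v, 0 < u -> u <= v -> 0 <= RInt f u v).
  { intros u v Hu Huv; apply RInt_ge_0; auto; intros; apply Hf; lra. }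
  destruct (completeness (fun y => exists u v, 0 < u /\ u <= v /\ y = RInt f u v))
    as [l [Hub Hlub]].
  - exists M; intros y [u [v [Hu [Huv ->]]]]; auto.
  - exists (RInt f 1 1), 1, 1; repeat split; lra.
  - assert (Hle : forall u v, 0 < u -> u <= v -> RInt f u v <= l).
    { intros u v Hu Huv; apply Hub; exists u, v; auto. }
    exists l; split; [|exact Hle].
    intros P [eps HP].
    assert (Hnear : exists u v, 0 < u /\ u <= v /\ l - eps < RInt f u v).
    { apply Classical_Prop.NNPP; intros Hn.
      assert (l <= l - eps); [|pose proof (cond_pos eps); lra].
      apply Hlub; intros y [u [v [Hu [Huv ->]]]].
      apply Rnot_lt_le; intros Hlt; apply Hn; exists u, v; auto. }
    destruct Hnear as [u0 [v0 [Hu0 [Huv0 Hlt]]]].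
    apply Filter_prod with (fun u => 0 < u < u0) (fun v => v0 < v).
    + exists (mkposreal u0 Hu0); intros u Hu Hpos; split; [exact Hpos|].
      unfold ball in Hu; simpl in Hu; unfold AbsRing_ball, abs, minus, plus, opp in Hu.
      simpl in Hu; apply Rabs_def2 in Hu; lra.
    + exists v0; auto.
    + intros u v [Hu Hu1] Hv; exists (RInt f u v); split.
      * apply (@RInt_correct R_CompleteNormedModule), Hex; simpl; lra.
      * apply HP; unfold ball; simpl; unfold AbsRing_ball, abs, minus, plus, opp; simpl.
        pose proof (Hge u u0 ltac:(lra) ltac:(lra)).
        pose proof (Hge v0 v ltac:(lra) ltac:(lra)).
        pose proof (Hle u v ltac:(lra) ltac:(lra)) as Hle'.
        assert (RInt f u v = RInt f u u0 + RInt f u0 v0 + RInt f v0 v) as E.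
        { rewrite <- (RInt_Chasles f u u0 v), <- (RInt_Chasles f u0 v0 v);
            try (apply Hex; lra).
          unfold plus; simpl; ring. }
        rewrite E in *; apply Rabs_def1; lra.
Qed.

Lemma exp_le (x y : R) : x <= y -> exp x <= exp y.
Proof.
  intros [H| ->]; [apply Rlt_le, exp_increasing, H|apply Rle_refl].
Qed.

Definition gamma_integrand (s t : R) : R := Rpower t (s - 1) * exp (- t).

Lemma gamma_integrand_pos (s t : R) : 0 < gamma_integrand s t.
Proof. apply Rmult_lt_0_compat; apply exp_pos. Qed.

Lemma gamma_integrand_continuous (s t : R) : 0 < t -> continuous (gamma_integrand s) t.
Proof.
  intros Ht; apply (@ex_derive_continuous R_AbsRing R_NormedModule).
  unfold gamma_integrand, Rpower; auto_derive; exact Ht.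
Qed.

(* The maximum of [(1 + t)^p exp (- t)] is attained at [1 + t = p]. *)
Lemma pow_exp_bound (p t : R) : 0 < p -> 0 < t ->
  exp (- t) <= exp (1 + p * ln p - p) * exp (- p * ln (1 + t)).
Proof.
  intros Hp Ht; rewrite <- exp_plus; apply exp_le.
  pose proof (exp_ineq1_le (ln ((1 + t) / p))) as H.
  rewrite exp_ln in H by (apply Rdiv_lt_0_compat; lra).
  rewrite ln_div in H by lra.
  apply (Rmult_le_compat_l p) in H; [|lra].
  replace (p * ((1 + t) / p)) with (1 + t) in H by (field; lra).
  lra.
Qed.

(* [(t / (1 + t))^s] is a bounded function whose derivative dominates the
   integrand up to a constant. *)
Lemma gamma_partial_bound (s : R) : 0 < s ->
  exists M, forall u v, 0 < u -> u <= v -> RInt (gamma_integrand s) u v <= M.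
Proof.
  (* [G] below has derivative [C s t^(s-1) / (1+t)^(s+1)], and [C s] is the constant of
     [pow_exp_bound] at [p = s + 1]. *)
  intros Hs; set (C := exp (1 + (s + 1) * ln (s + 1) - (s + 1)) / s).
  assert (HC : 0 < C) by (apply Rdiv_lt_0_compat; [apply exp_pos|exact Hs]).
  exists C; intros u v Hu Huv.
  set (G := fun t => C * exp (s * (ln t - ln (1 + t)))).
  set (g := fun t => C * (exp (s * (ln t - ln (1 + t))) * (s * (/ t - / (1 + t))))).
  assert (HG : forall t, 0 < t -> is_derive G t (g t)).
  { intros t Ht; unfold G, g; auto_derive; [repeat split; lra|].
    unfold Rdiv, Rminus; field; lra. }
  assert (Hgc : forall t, 0 < t -> continuous g t).
  { intros t Ht; apply (@ex_derive_continuous R_AbsRing R_NormedModule).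
    unfold g; auto_derive; repeat split; lra. }
  assert (HI : is_RInt g u v (G v - G u)).
  { apply (is_RInt_derive G g); rewrite Rmin_left, Rmax_right by lra; intros t Ht;
      [apply HG|apply Hgc]; lra. }
  assert (HF : is_RInt (gamma_integrand s) u v (RInt (gamma_integrand s) u v)).
  { apply (@RInt_correct R_CompleteNormedModule).
    apply (@ex_RInt_continuous R_CompleteNormedModule).
    intros z; rewrite Rmin_left, Rmax_right by lra; intros Hz.
    apply gamma_integrand_continuous; lra. }
  apply Rle_trans with (G v - G u).
  - apply (is_RInt_le (gamma_integrand s) g u v); auto.
    intros t Ht; unfold gamma_integrand, g, Rpower.
    pose proof (pow_exp_bound (s + 1) t ltac:(lra) ltac:(lra)) as Hb.
    replace ((s - 1) * ln t) with (s * ln t + - ln t) by ring.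
    rewrite exp_plus, exp_Ropp, exp_ln by lra.
    replace (s * (ln t - ln (1 + t))) with (s * ln t + - (s + 1) * ln (1 + t) + ln (1 + t))
      by ring.
    rewrite !exp_plus, (exp_ln (1 + t)) by lra.
    replace (C * (exp (s * ln t) * exp (- (s + 1) * ln (1 + t)) * (1 + t)
                    * (s * (/ t - / (1 + t)))))
      with (exp (s * ln t) * / t *
        (exp (1 + (s + 1) * ln (s + 1) - (s + 1)) * exp (- (s + 1) * ln (1 + t))))
      by (unfold C; field; lra).
    apply Rmult_le_compat_l; [|exact Hb].
    apply Rmult_le_pos; [apply Rlt_le, exp_pos|apply Rlt_le, Rinv_0_lt_compat; lra].
  - assert (0 < G u) by (apply Rmult_lt_0_compat; [exact HC|apply exp_pos]).
    assert (G v <= C * 1); [|lra].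
    apply Rmult_le_compat_l; [lra|].
    apply Rle_trans with (exp 0); [apply exp_le|rewrite exp_0; lra].
    assert (ln v < ln (1 + v)) by (apply ln_increasing; lra); nra.
Qed.

Lemma Gamma_unique (s l : R) :
  is_RInt_gen (gamma_integrand s) (at_right 0) (Rbar_locally p_infty) l -> Gamma s = l.
Proof.
  intros H.
  change (RInt_gen (gamma_integrand s) (at_right 0) (Rbar_locally p_infty) = l).
  exact (@is_RInt_gen_unique R_CompleteNormedModule (at_right 0) (Rbar_locally p_infty)
    _ _ (gamma_integrand s) l H).
Qed.

Lemma is_RInt_gen_Gamma (s : R) : 0 < s ->
  is_RInt_gen (gamma_integrand s) (at_right 0) (Rbar_locally p_infty) (Gamma s)
  /\ 0 < Gamma s.
Proof.
  intros Hs; destruct (gamma_partial_bound s Hs) as [M HM].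
  destruct (is_RInt_gen_bounded (gamma_integrand s) M) as [l [Hl Hle]]; auto.
  - apply gamma_integrand_continuous.
  - intros; apply Rlt_le, gamma_integrand_pos.
  - rewrite (Gamma_unique s l Hl); split; [exact Hl|].
    apply Rlt_le_trans with (RInt (gamma_integrand s) 1 2); [|apply Hle; lra].
    apply RInt_gt_0; [lra| |].
    + intros; apply gamma_integrand_pos.
    + intros; apply gamma_integrand_continuous; lra.
Qed.

Lemma Gamma_pos (s : R) : 0 < s -> 0 < Gamma s.
Proof. intros Hs; apply is_RInt_gen_Gamma, Hs. Qed.

Lemma Gamma_succ (s : R) : 0 < s -> Gamma (s + 1) = s * Gamma s.
Proof.
  intros Hs; set (h := fun t => exp (s * ln t) * exp (- t)).
  set (h' := fun t => s * gamma_integrand s t - gamma_integrand (s + 1) t).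
  assert (Hd : forall t, 0 < t -> is_derive h t (h' t)).
  { intros t Ht; unfold h, h', gamma_integrand, Rpower; auto_derive; [lra|].
    replace ((s - 1) * ln t) with (s * ln t + - ln t) by ring.
    replace (s + 1 - 1) with s by ring.
    rewrite exp_plus, (exp_Ropp (ln t)), exp_ln by lra; field; lra. }
  assert (Hpos : forall t, 0 < t -> locally t (fun y => 0 < y)).
  { intros t Ht; apply (open_gt 0 t Ht). }
  assert (HI : is_RInt_gen (Derive h) (at_right 0) (Rbar_locally p_infty) (0 - 0)).
  { apply is_RInt_gen_Derive.
    - apply (filter_prod_positive_axis (fun u v => forall x,
        Rmin u v <= x <= Rmax u v -> ex_derive h x)).
      intros u v Hu Huv x; rewrite Rmin_left, Rmax_right by lra; intros Hx.
      exists (h' x); apply Hd; lra.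
    - apply (filter_prod_positive_axis (fun u v => forall x,
        Rmin u v <= x <= Rmax u v -> continuous (Derive h) x)).
      intros u v Hu Huv x; rewrite Rmin_left, Rmax_right by lra; intros Hx.
      apply continuous_ext_loc with h'.
      + apply filter_imp with (2 := Hpos x ltac:(lra)); intros y Hy.
        symmetry; apply is_derive_unique, Hd, Hy.
      + apply (@continuous_minus R_UniformSpace R_AbsRing R_NormedModule).
        * apply (@continuous_scal_r R_UniformSpace R_AbsRing R_NormedModule s).
          apply gamma_integrand_continuous; lra.
        * apply gamma_integrand_continuous; lra.
    - intros P [eps HP].
      exists (mkposreal _ (exp_pos (ln eps / s))); intros t Ht Ht0; apply HP.
      unfold ball in *; simpl in *; unfold AbsRing_ball, abs, minus, plus, opp in *; simpl in *.
      apply Rabs_def2 in Ht; destruct Ht as [Ht _].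
      assert (Hlt : ln t < ln eps / s).
      { rewrite <- (ln_exp (ln eps / s)); apply ln_increasing; lra. }
      assert (s * ln t < ln eps).
      { apply (Rmult_lt_compat_l s) in Hlt; [|exact Hs].
        replace (s * (ln eps / s)) with (ln eps) in Hlt by (field; lra); exact Hlt. }
      assert (0 < h t) by (apply Rmult_lt_0_compat; apply exp_pos).
      assert (h t < eps).
      { unfold h; rewrite <- exp_plus, <- (exp_ln eps) by apply cond_pos.
        apply exp_increasing; lra. }
      pose proof (cond_pos eps); apply Rabs_def1; lra.
    - intros P [eps HP].
      (* With [p = s + 1] in [pow_exp_bound], [h t <= C / (1 + t)], which is below [eps] once
         [t > C / eps]. *)
      set (C := exp (1 + (s + 1) * ln (s + 1) - (s + 1))).
      assert (HC : 0 < C) by apply exp_pos.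
      pose proof (cond_pos eps) as Heps.
      exists (C / eps); intros t Ht; apply HP.
      assert (Hce : 0 < C / eps) by (apply Rdiv_lt_0_compat; lra).
      unfold ball; simpl; unfold AbsRing_ball, abs, minus, plus, opp; simpl.
      assert (0 < h t) by (apply Rmult_lt_0_compat; apply exp_pos).
      assert (h t < eps).
      { pose proof (pow_exp_bound (s + 1) t ltac:(lra) ltac:(lra)) as Hb; fold C in Hb.
        assert (ln t < ln (1 + t)) by (apply ln_increasing; lra).
        assert (exp (s * ln t) <= exp (s * ln (1 + t))) by (apply exp_le; nra).
        apply Rle_lt_trans with
          (exp (s * ln (1 + t)) * (C * exp (- (s + 1) * ln (1 + t)))).
        - apply Rmult_le_compat; auto; apply Rlt_le, exp_pos.
        - replace (- (s + 1) * ln (1 + t)) with (- (s * ln (1 + t)) + - ln (1 + t)) by ring.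
          rewrite exp_plus, !exp_Ropp, (exp_ln (1 + t)) by lra.
          pose proof (exp_pos (s * ln (1 + t))).
          replace (_ * _) with (C / (1 + t)) by (field; lra).
          apply Rmult_lt_reg_r with (1 + t); [lra|].
          replace (C / (1 + t) * (1 + t)) with C by (field; lra).
          apply (Rmult_lt_compat_l eps) in Ht; [|exact Heps].
          replace (eps * (C / eps)) with C in Ht by (field; lra); lra. }
      apply Rabs_def1; lra. }
  destruct (is_RInt_gen_Gamma s Hs) as [Gs _].
  destruct (is_RInt_gen_Gamma (s + 1) ltac:(lra)) as [Gs1 _].
  pose proof (is_RInt_gen_minus _ _ _ _ (is_RInt_gen_scal _ s _ Gs) HI) as H.
  apply Gamma_unique.
  replace (s * Gamma s) with (minus (scal s (Gamma s)) (0 - 0))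
    by (unfold minus, plus, opp, scal; simpl; unfold mult; simpl; ring).
  apply is_RInt_gen_ext with (2 := H).
  apply (filter_prod_positive_axis (fun u v => forall x, Rmin u v < x < Rmax u v -> _ = _)).
  intros u v Hu Huv x; rewrite Rmin_left, Rmax_right by lra; intros Hx.
  rewrite (is_derive_unique _ _ _ (Hd x ltac:(lra))).
  unfold h', gamma_integrand, minus, plus, opp, scal; simpl; unfold mult; simpl; ring.
Qed.

(* Chebyshev's inequality for the increasing functions [t^d] and [t^(B - A)]
   against the weight [t^(A - 1) exp (- t)]. Recentring the first at its mean [mu]
   and the second at its value [nu] at the same point avoids the double integral. *)
Lemma Gamma_supermodular (A B d : R) : 0 < A -> A <= B -> 0 < d ->
  Gamma (A + d) * Gamma B <= Gamma (B + d) * Gamma A.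
Proof.
  intros HA HAB Hd.
  destruct (is_RInt_gen_Gamma A HA) as [IA PA].
  destruct (is_RInt_gen_Gamma B ltac:(lra)) as [IB PB].
  destruct (is_RInt_gen_Gamma (A + d) ltac:(lra)) as [IAd PAd].
  destruct (is_RInt_gen_Gamma (B + d) ltac:(lra)) as [IBd PBd].
  set (mu := Gamma (A + d) / Gamma A).
  assert (Hmu : 0 < mu) by (apply Rdiv_lt_0_compat; assumption).
  set (tau := ln mu / d); set (nu := exp ((B - A) * tau)).
  assert (Emu : mu = exp (d * tau)).
  { unfold tau; replace (d * (ln mu / d)) with (ln mu) by (field; lra).
    symmetry; apply exp_ln, Hmu. }
  pose proof (is_RInt_gen_plus _ _ _ _
    (is_RInt_gen_minus _ _ _ _ IBd (is_RInt_gen_scal _ mu _ IB))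
    (is_RInt_gen_minus _ _ _ _ (is_RInt_gen_scal _ (mu * nu) _ IA)
       (is_RInt_gen_scal _ nu _ IAd))) as H.
  apply is_RInt_gen_nonneg in H.
  - unfold plus, minus, opp, scal in H; simpl in H; unfold plus, mult in H; simpl in H.
    (* As [mu] is the mean, the two terms carrying [nu] cancel. *)
    assert (E : mu * Gamma A = Gamma (A + d)) by (unfold mu; field; lra).
    replace (mu * nu * Gamma A) with (nu * (mu * Gamma A)) in H by ring.
    rewrite E in H; rewrite <- E; nra.
  - intros t Ht; unfold plus, minus, opp, scal; simpl; unfold plus, mult; simpl.
    unfold gamma_integrand, Rpower.
    replace ((B + d - 1) * ln t) with ((A - 1) * ln t + (B - A) * ln t + d * ln t) by ring.
    replace ((B - 1) * ln t) with ((A - 1) * ln t + (B - A) * ln t) by ring.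
    replace ((A + d - 1) * ln t) with ((A - 1) * ln t + d * ln t) by ring.
    rewrite !exp_plus, Emu.
    set (w := exp ((A - 1) * ln t)); set (f := exp (d * ln t)).
    set (g := exp ((B - A) * ln t)).
    replace (_ + _) with (w * exp (- t) * ((f - exp (d * tau)) * (g - nu))) by ring.
    apply Rmult_le_pos.
    { apply Rmult_le_pos; apply Rlt_le, exp_pos. }
    destruct (Rle_dec tau (ln t)) as [Hle|Hgt].
    + assert (exp (d * tau) <= f) by (apply exp_le; nra).
      assert (nu <= g) by (apply exp_le; nra).
      apply Rmult_le_pos; lra.
    + assert (f <= exp (d * tau)) by (apply exp_le; nra).
      assert (g <= nu) by (apply exp_le; nra).
      rewrite <- Rmult_opp_opp; apply Rmult_le_pos; lra.
Qed.

Lemma Gamma_poch (s : R) (n : nat) : 0 < s -> Gamma (s + INR n) = poch s n * Gamma s.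
Proof.
  intros Hs; induction n as [|n IH].
  - simpl; rewrite Rplus_0_r; ring.
  - pose proof (pos_INR n).
    rewrite S_INR, <- Rplus_assoc, Gamma_succ, IH by lra; simpl; ring.
Qed.

(** * The Gamma quotient as a limit of Pochhammer quotients *)

Definition gamma_ratio (a b d : R) : R :=
  Gamma (a + d) * Gamma b / (Gamma (b + d) * Gamma a).

Lemma gamma_ratio_pos (a b d : R) : 0 < a -> 0 < b -> 0 < d -> 0 < gamma_ratio a b d.
Proof.
  intros; apply Rdiv_lt_0_compat; apply Rmult_lt_0_compat; apply Gamma_pos; lra.
Qed.

(** Supermodularity of [Gamma] gives only a weak inequality. Applying it at [k + 1] and going back
    one step makes it strict, since [(a+k)(b+d+k) < (a+d+k)(b+k)]. *)
Lemma gamma_ratio_lt_poch (a b d : R) (k : nat) : 0 < a -> a < b -> 0 < d ->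
  gamma_ratio a b d * (poch (a + d) k * poch b k) < poch a k * poch (b + d) k.
Proof.
  intros Ha Hab Hd; set (L := gamma_ratio a b d).
  pose proof (pos_INR (S k)); pose proof (pos_INR k).
  pose proof (Gamma_supermodular (a + INR (S k)) (b + INR (S k)) d
    ltac:(lra) ltac:(lra) Hd) as H1.
  replace (a + INR (S k) + d) with (a + d + INR (S k)) in H1 by ring.
  replace (b + INR (S k) + d) with (b + d + INR (S k)) in H1 by ring.
  rewrite !Gamma_poch in H1 by lra.
  assert (PG : 0 < Gamma (b + d) * Gamma a)
    by (apply Rmult_lt_0_compat; apply Gamma_pos; lra).
  assert (EL : L * (Gamma (b + d) * Gamma a) = Gamma (a + d) * Gamma b).
  { unfold L, gamma_ratio; field; split; apply Rgt_not_eq, Gamma_pos; lra. }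
  assert (H2 : L * (poch (a + d) (S k) * poch b (S k)) <= poch a (S k) * poch (b + d) (S k)).
  { apply Rmult_le_reg_r with (Gamma (b + d) * Gamma a); [exact PG|].
    replace (L * (poch (a + d) (S k) * poch b (S k)) * (Gamma (b + d) * Gamma a)) with
      (L * (Gamma (b + d) * Gamma a) * (poch (a + d) (S k) * poch b (S k))) by ring.
    rewrite EL; lra. }
  simpl in H2.
  assert (0 < poch a k * poch (b + d) k)
    by (apply Rmult_lt_0_compat; apply poch_pos; lra).
  set (p := poch a k * poch (b + d) k) in *.
  set (q := poch (a + d) k * poch b k) in *.
  set (n := INR k) in *.
  assert (Hle : L * q * ((a + d + n) * (b + n)) <= p * ((a + n) * (b + d + n)))
    by (unfold p, q; lra).
  assert (H4 : (a + n) * (b + d + n) < (a + d + n) * (b + n)) by nra.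
  assert (0 < (a + d + n) * (b + n)) by (apply Rmult_lt_0_compat; lra).
  apply Rmult_lt_reg_r with ((a + d + n) * (b + n)); [assumption|].
  apply Rle_lt_trans with (1 := Hle); apply Rmult_lt_compat_l; assumption.
Qed.

Lemma poch_shift_bound (y d : R) (N : nat) : 0 < y -> 0 <= d ->
  poch (y + d) N <= (1 + d * / y) ^ N * poch y N.
Proof.
  intros Hy Hd; induction N as [|N IH]; simpl; [lra|].
  pose proof (pos_INR N); pose proof (Rinv_0_lt_compat y Hy).
  replace ((1 + d * / y) * (1 + d * / y) ^ N * (poch y N * (y + INR N)))
    with ((1 + d * / y) ^ N * poch y N * ((1 + d * / y) * (y + INR N))) by ring.
  apply Rmult_le_compat; [apply poch_nonneg; lra|lra|exact IH|].
  replace ((1 + d * / y) * (y + INR N)) with (y + INR N + d + d * / y * INR N)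
    by (field; lra).
  assert (0 <= d * / y * INR N) by (repeat apply Rmult_le_pos; lra); lra.
Qed.

(** Supermodularity is used in the opposite direction, by moving [a + n] past [b + n] with an
    integer shift [N >= b - a]. The cost is [(a+d+n)_N / (a+n)_N <= (1 + d/(a+n))^N], which tends to
    1 because [N] is fixed. *)
Lemma poch_ratio_near_gamma_ratio (a b d eps : R) : 0 < a -> a < b -> 0 < d -> 0 < eps ->
  exists n, poch a n * poch (b + d) n / (poch (a + d) n * poch b n)
              < gamma_ratio a b d + eps.
Proof.
  intros Ha Hab Hd Heps; set (L := gamma_ratio a b d).
  pose proof (gamma_ratio_pos a b d Ha ltac:(lra) Hd) as HL; fold L in HL.
  destruct (nfloor_ex (b - a) ltac:(lra)) as [N0 [_ HN0]].
  set (N := S N0); assert (HN : b <= a + INR N) by (unfold N; rewrite S_INR; lra).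
  assert (Hcont : continuity_pt (fun y => L * (1 + d * y) ^ N) 0).
  { apply continuity_pt_filterlim.
    change (continuous (fun y => L * (1 + d * y) ^ N) 0).
    apply (@ex_derive_continuous R_AbsRing R_NormedModule); auto_derive; exact I. }
  assert (Hinv : is_lim_seq (fun n => / (INR n + a)) 0).
  { apply (is_lim_seq_inv _ p_infty); [|discriminate].
    apply (is_lim_seq_plus _ _ p_infty a p_infty);
      [apply is_lim_seq_INR|apply is_lim_seq_const|reflexivity]. }
  pose proof (is_lim_seq_continuous _ _ _ Hcont Hinv) as Hlim; cbv beta in Hlim.
  rewrite Rmult_0_r, Rplus_0_r, pow1, Rmult_1_r in Hlim.
  destruct (proj2 (is_lim_seq_spec _ _) Hlim (mkposreal _ Heps)) as [n Hn].
  specialize (Hn n (Nat.le_refl n)); cbn beta iota delta [pos] in Hn; apply Rabs_def2 in Hn.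
  exists n; apply Rle_lt_trans with (L * (1 + d * / (INR n + a)) ^ N); [|lra].
  pose proof (pos_INR n); pose proof (pos_INR N).
  pose proof (Gamma_supermodular (b + INR n) (a + INR n + INR N) d
    ltac:(lra) ltac:(lra) Hd) as H1.
  replace (b + INR n + d) with (b + d + INR n) in H1 by ring.
  replace (a + INR n + INR N + d) with (a + d + INR n + INR N) in H1 by ring.
  rewrite (Gamma_poch (a + INR n)), (Gamma_poch (a + d + INR n)) in H1 by lra.
  rewrite !Gamma_poch in H1 by lra.
  pose proof (poch_shift_bound (a + INR n) d N ltac:(lra) ltac:(lra)) as H2.
  replace (a + INR n + d) with (a + d + INR n) in H2 by ring.
  replace (INR n + a) with (a + INR n) in * by ring.
  set (T := (1 + d * / (a + INR n)) ^ N) in *.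
  assert (P1 : 0 < poch (a + INR n) N) by (apply poch_pos; lra).
  assert (PG : 0 < Gamma (b + d) * Gamma a)
    by (apply Rmult_lt_0_compat; apply Gamma_pos; lra).
  assert (PG' : 0 < Gamma (a + d) * Gamma b)
    by (apply Rmult_lt_0_compat; apply Gamma_pos; lra).
  assert (EL : L * (Gamma (b + d) * Gamma a) = Gamma (a + d) * Gamma b).
  { unfold L, gamma_ratio; field; split; apply Rgt_not_eq, Gamma_pos; lra. }
  assert (PD : 0 < poch (a + d) n * poch b n)
    by (apply Rmult_lt_0_compat; apply poch_pos; lra).
  apply Rmult_le_reg_r with (poch (a + d) n * poch b n); [exact PD|].
  unfold Rdiv; rewrite Rmult_assoc, Rinv_l, Rmult_1_r by lra.
  apply Rmult_le_reg_r with (Gamma (b + d) * Gamma a); [exact PG|].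
  replace (L * T * (poch (a + d) n * poch b n) * (Gamma (b + d) * Gamma a)) with
    (L * (Gamma (b + d) * Gamma a) * T * (poch (a + d) n * poch b n)) by ring.
  rewrite EL.
  apply Rmult_le_reg_r with (poch (a + INR n) N); [exact P1|].
  apply Rle_trans with (Gamma (a + d) * Gamma b * (poch (a + d) n * poch b n)
    * poch (a + d + INR n) N); [lra|].
  replace (Gamma (a + d) * Gamma b * T * (poch (a + d) n * poch b n) * poch (a + INR n) N)
    with (Gamma (a + d) * Gamma b * (poch (a + d) n * poch b n) * (T * poch (a + INR n) N))
    by ring.
  apply Rmult_le_compat_l; [|exact H2].
  apply Rlt_le, Rmult_lt_0_compat; assumption.
Qed.

(** * The ratio of Kummer functions *)

Lemma kratio_lt_1 (d a b c x : R) : 0 <= a -> a < b -> 0 < c -> 0 < d -> 0 < x ->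
  kratio d a b c x < 1.
Proof.
  intros Ha Hab Hc Hd Hx; unfold kratio.
  pose proof (F11_turan a b c d x Ha Hab Hc Hd Hx).
  assert (0 < F11 (a + d) c x * F11 b c x)
    by (apply Rmult_lt_0_compat; apply F11_pos; lra).
  apply Rmult_lt_reg_r with (F11 (a + d) c x * F11 b c x); [assumption|].
  unfold Rdiv; rewrite Rmult_assoc, Rinv_l by lra; lra.
Qed.

Lemma gamma_ratio_lt_kratio (d a b c x : R) : 0 < a -> a < b -> 0 < c -> 0 < d -> 0 < x ->
  gamma_ratio a b d < kratio d a b c x.
Proof.
  intros Ha Hab Hc Hd Hx; unfold kratio.
  pose proof (F11_turan_lower a b c d (gamma_ratio a b d) x Ha Hab Hc Hd
    (Rlt_le _ _ (gamma_ratio_pos a b d Ha ltac:(lra) Hd)) Hx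
    (fun k => gamma_ratio_lt_poch a b d k Ha Hab Hd)).
  assert (0 < F11 (a + d) c x * F11 b c x)
    by (apply Rmult_lt_0_compat; apply F11_pos; lra).
  apply Rmult_lt_reg_r with (F11 (a + d) c x * F11 b c x); [assumption|].
  unfold Rdiv; rewrite (Rmult_assoc (_ * _)), Rinv_l by lra; lra.
Qed.

Lemma kratio_at_0 (d a b c : R) : 0 < c -> kratio d a b c 0 = 1.
Proof. intros Hc; unfold kratio; rewrite !F11_at_0 by exact Hc; field. Qed.

(** With [r y x = y F11 (y+1) c x / (x F11 y c x)], each of the four functions is
    [F11 y = y F11 (y+1) / (x r)]. The powers of [x] cancel, the factors [y] build the Pochhammer
    quotient, and [theta] collects the [r]. *)
Lemma kratio_shift (d c : R) (n : nat) : 0 < c -> 0 < d -> forall a b : R,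
  0 < a -> 0 < b -> exists theta : R -> R, is_lim theta p_infty 1 /\
    forall x, 0 < x -> kratio d a b c x =
      poch a n * poch (b + d) n / (poch (a + d) n * poch b n) * theta x *
      kratio d (a + INR n) (b + INR n) c x.
Proof.
  intros Hc Hd; induction n as [|n IH]; intros a b Ha Hb.
  - exists (fun _ => 1); split; [apply is_lim_const|].
    intros x Hx; simpl; rewrite !Rplus_0_r; field.
  - destruct (IH (a + 1) (b + 1) ltac:(lra) ltac:(lra)) as [th [Hth Heq]].
    set (r := fun y x => y * F11 (y + 1) c x / (x * F11 y c x)).
    assert (Hr : forall y, 0 < y -> is_lim (r y) p_infty 1)
      by (intros y Hy; apply F11_contiguous_lim; assumption).
    exists (fun x => r (a + d) x * r b x / (r (b + d) x * r a x) * th x); split.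
    + replace (Finite 1) with (Finite (1 * 1 / (1 * 1) * 1)) by (f_equal; field).
      assert (Hm : forall u v, 0 < u -> 0 < v ->
        is_lim (fun x => r u x * r v x) p_infty (1 * 1)).
      { intros u v Hu Hv; apply (is_lim_mult _ _ p_infty 1 1); auto; exact I. }
      apply (is_lim_mult _ _ p_infty (1 * 1 / (1 * 1)) 1); auto; [|exact I].
      apply (is_lim_div _ _ p_infty (1 * 1) (1 * 1)); try (apply Hm; lra).
      * intros E; injection E; lra.
      * exact I.
    + intros x Hx; specialize (Heq x Hx).
      rewrite S_INR, !poch_succ_l.
      replace (a + (INR n + 1)) with (a + 1 + INR n) by ring.
      replace (b + (INR n + 1)) with (b + 1 + INR n) by ring.
      replace (a + d + 1) with (a + 1 + d) by ring.
      replace (b + d + 1) with (b + 1 + d) by ring.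
      set (K := kratio d (a + 1 + INR n) (b + 1 + INR n) c x) in *.
      set (Q := poch (a + 1) n * poch (b + 1 + d) n /
        (poch (a + 1 + d) n * poch (b + 1) n)) in *.
      assert (PF : forall y, 0 < y -> 0 < F11 y c x)
        by (intros y Hy; apply F11_pos; lra).
      replace (kratio d a b c x) with
        (a * (b + d) / ((a + d) * b) * (r (a + d) x * r b x / (r (b + d) x * r a x)) *
         kratio d (a + 1) (b + 1) c x).
      * rewrite Heq; unfold Q; pose proof (poch_pos (a + 1 + d) n ltac:(lra)).
        pose proof (poch_pos (b + 1) n ltac:(lra)).
        set (z := r (a + d) x * r b x / (r (b + d) x * r a x)).
        field; repeat split; lra.
      * unfold kratio, r.
        replace (a + d + 1) with (a + 1 + d) by ring.
        replace (b + d + 1) with (b + 1 + d) by ring.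
        pose proof (PF a Ha); pose proof (PF b Hb).
        pose proof (PF (a + d) ltac:(lra)); pose proof (PF (b + d) ltac:(lra)).
        pose proof (PF (a + 1) ltac:(lra)); pose proof (PF (b + 1) ltac:(lra)).
        pose proof (PF (a + 1 + d) ltac:(lra)); pose proof (PF (b + 1 + d) ltac:(lra)).
        field; repeat split; lra.
Qed.

Lemma is_lim_kratio (d a b c : R) : 0 < a -> a < b -> 0 < c -> 0 < d ->
  is_lim (kratio d a b c) p_infty (gamma_ratio a b d).
Proof.
  intros Ha Hab Hc Hd; apply is_lim_spec; intros eps.
  destruct (poch_ratio_near_gamma_ratio a b d eps Ha Hab Hd (cond_pos eps)) as [n Hn].
  destruct (kratio_shift d c n Hc Hd a b Ha ltac:(lra)) as [th [Hth Heq]].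
  set (L := gamma_ratio a b d) in *.
  set (Q := poch a n * poch (b + d) n / (poch (a + d) n * poch b n)) in *.
  assert (HQ : 0 < Q).
  { apply Rdiv_lt_0_compat; apply Rmult_lt_0_compat; apply poch_pos; lra. }
  assert (HL : 0 < L) by (apply gamma_ratio_pos; lra).
  (* The tolerance for [theta] that makes [Q * theta < L + eps]; it is positive because
     [Q < L + eps]. *)
  assert (He : 0 < (L + eps) / Q - 1).
  { replace ((L + eps) / Q - 1) with ((L + eps - Q) / Q) by (field; lra).
    apply Rdiv_lt_0_compat; lra. }
  apply is_lim_spec in Hth.
  destruct (Hth (mkposreal _ He)) as [M HM].
  exists (Rmax M 0); intros x Hx.
  assert (HxM : M < x) by (apply Rle_lt_trans with (2 := Hx), Rmax_l).
  assert (Hx0 : 0 < x) by (apply Rle_lt_trans with (2 := Hx), Rmax_r).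
  pose proof (gamma_ratio_lt_kratio d a b c x Ha Hab Hc Hd Hx0) as Hlow; fold L in Hlow.
  specialize (HM x HxM); simpl in HM; apply Rabs_def2 in HM; destruct HM as [HM _].
  pose proof (pos_INR n).
  pose proof (kratio_lt_1 d (a + INR n) (b + INR n) c x
    ltac:(lra) ltac:(lra) Hc Hd Hx0) as Hup.
  pose proof (gamma_ratio_lt_kratio d (a + INR n) (b + INR n) c x
    ltac:(lra) ltac:(lra) Hc Hd Hx0) as Hpos.
  pose proof (gamma_ratio_pos (a + INR n) (b + INR n) d ltac:(lra) ltac:(lra) Hd).
  specialize (Heq x Hx0).
  set (K := kratio d (a + INR n) (b + INR n) c x) in *.
  assert (HQt : Q * th x < L + eps).
  { apply (Rmult_lt_compat_l Q) in HM; [|exact HQ].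
    replace (Q * ((L + eps) / Q - 1)) with (L + eps - Q) in HM by (field; lra); lra. }
  assert (kratio d a b c x < L + eps).
  { rewrite Heq in *.
    (* The sign comes from the lower bound: [0 < L < Q * th x * K] with [K > 0]. Then [K < 1]
       finishes the estimate. *)
    assert (0 < Q * th x) by nra.
    nra. }
  apply Rabs_def1; lra.
Qed.

(** The exponentials cancel, and the reflection exchanges the roles of [a] and [b], so that
    [a < b < c - d] becomes [0 < c - b - d < c - a - d]. This carries the results for [x > 0] over
    to [x < 0]. *)
Lemma kratio_kummer (d a b c x : R) : 0 < c ->
  kratio d a b c x = kratio d (c - b - d) (c - a - d) c (- x).
Proof.
  intros Hc; unfold kratio.
  rewrite (kummer_transformation (b + d) c x Hc), (kummer_transformation a c x Hc).
  rewrite (kummer_transformation (a + d) c x Hc), (kummer_transformation b c x Hc).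
  replace (c - (b + d)) with (c - b - d) by ring.
  replace (c - (a + d)) with (c - a - d) by ring.
  replace (c - a - d + d) with (c - a) by ring.
  replace (c - b - d + d) with (c - b) by ring.
  pose proof (exp_pos x).
  set (p := F11 (c - b - d) c (- x)); set (q := F11 (c - a) c (- x)).
  set (r := F11 (c - a - d) c (- x)); set (s := F11 (c - b) c (- x)).
  replace (exp x * p * (exp x * q)) with ((exp x * exp x) * (q * p)) by ring.
  replace (exp x * r * (exp x * s)) with ((exp x * exp x) * (s * r)) by ring.
  apply Rdiv_mult_l_l; apply Rgt_not_eq, Rmult_lt_0_compat; assumption.
Qed.

Lemma F11_ratio_le (a1 a2 c d x : R) : 0 <= a1 -> a1 <= a2 -> 0 < c -> 0 < d -> 0 < x ->
  F11 (a2 + d) c x / F11 a2 c x <= F11 (a1 + d) c x / F11 a1 c x.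
Proof.
  intros H1 H12 Hc Hd Hx.
  pose proof (F11_pos a1 c x H1 Hc ltac:(lra)).
  pose proof (F11_pos a2 c x ltac:(lra) Hc ltac:(lra)).
  apply Rle_div_l; [assumption|].
  replace (F11 (a1 + d) c x / F11 a1 c x * F11 a2 c x)
    with (F11 (a1 + d) c x * F11 a2 c x / F11 a1 c x) by (field; lra).
  apply Rle_div_r; [assumption|].
  apply F11_turan_le; assumption.
Qed.

Lemma F11_ratio_le_neg (a1 a2 c d x : R) : a1 <= a2 -> a2 <= c - d -> 0 < c -> 0 < d -> x < 0 ->
  F11 (a2 + d) c x / F11 a2 c x <= F11 (a1 + d) c x / F11 a1 c x.
Proof.
  intros H12 H2 Hc Hd Hx.
  rewrite (kummer_transformation (a2 + d) c x Hc), (kummer_transformation a2 c x Hc).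
  rewrite (kummer_transformation (a1 + d) c x Hc), (kummer_transformation a1 c x Hc).
  pose proof (exp_pos x).
  pose proof (F11_turan_le (c - (a2 + d)) (c - (a1 + d)) c d (- x)
    ltac:(lra) ltac:(lra) Hc Hd ltac:(lra)) as Ht.
  replace (c - (a1 + d) + d) with (c - a1) in Ht by ring.
  replace (c - (a2 + d) + d) with (c - a2) in Ht by ring.
  pose proof (F11_pos (c - a1) c (- x) ltac:(lra) Hc ltac:(lra)).
  pose proof (F11_pos (c - a2) c (- x) ltac:(lra) Hc ltac:(lra)).
  rewrite !Rdiv_mult_l_l by lra.
  apply Rle_div_l; [assumption|].
  replace (_ / _ * _) with
    (F11 (c - (a1 + d)) c (- x) * F11 (c - a2) c (- x) / F11 (c - a1) c (- x))
    by (field; lra).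
  apply Rle_div_r; [assumption|]; lra.
Qed.

(** * The terminating hypergeometric sum *)

Lemma poch_shift_div (e : R) (n : nat) : e <> 0 -> poch (- e) n <> 0 ->
  poch (1 - e) n / poch (- e) n = 1 - INR n / e.
Proof.
  intros He Hn; pose proof (poch_shift (- e) n) as H.
  replace (- e + 1) with (1 - e) in H by ring.
  apply Rmult_eq_reg_r with (- e * poch (- e) n).
  2: { apply Rmult_integral_contrapositive; split; [lra|exact Hn]. }
  replace (poch (1 - e) n / poch (- e) n * (- e * poch (- e) n))
    with (- e * poch (1 - e) n) by (field; exact Hn).
  rewrite H; field; exact He.
Qed.

(** Reversing the three negative symbols gives the binomial coefficient and the weight; their signs
    cancel against [(-1)^n]. The pair [1 - e] over [-e] telescopes to the linear factor
    [1 - n/e]. *)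
Lemma pFq_4F3_term (a b c e : R) (m n : nat) : 0 < b -> 0 < c -> (n <= m)%nat ->
  e <> 0 -> poch (- e) n <> 0 ->
  prod_poch (- INR m :: a :: 1 - c - INR m :: 1 - e :: nil) n /
    prod_poch (c :: 1 - b - INR m :: - e :: nil) n * (-1) ^ n / INR (fact n) =
  poch c m / poch b m * (Binomial.C m n * cweight c m n *
    (poch a n * poch b (m - n)) * (1 - INR n / e)).
Proof.
  intros Hb Hc Hn He Hen; rewrite <- poch_shift_div by assumption.
  pose proof (poch_reflect 1 m n Hn) as R1; pose proof (poch_reflect c m n Hn) as Rc.
  pose proof (poch_reflect b m n Hn) as Rb.
  replace (1 - 1 - INR m) with (- INR m) in R1 by ring.
  rewrite !poch_1 in R1.
  pose proof (INR_fact_lt_0 m); pose proof (INR_fact_lt_0 n).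
  pose proof (INR_fact_lt_0 (m - n)).
  pose proof (poch_pos c n Hc); pose proof (poch_pos c m Hc).
  pose proof (poch_pos c (m - n) Hc); pose proof (poch_pos b m Hb).
  pose proof (poch_pos b (m - n) Hb).
  assert (Hs : (-1) ^ n * (-1) ^ n = 1).
  { rewrite <- Rpow_mult_distr; replace (-1 * -1) with 1 by ring; apply pow1. }
  set (s := (-1) ^ n) in *.
  assert (Hs0 : s <> 0) by (intros E; rewrite E in Hs; lra).
  assert (E1 : poch (- INR m) n = s * INR (fact m) / INR (fact (m - n)))
    by (apply Rmult_eq_reg_l with (INR (fact (m - n))); [rewrite R1; field|]; lra).
  assert (Ec : poch (1 - c - INR m) n = s * poch c m / poch c (m - n))
    by (apply Rmult_eq_reg_l with (poch c (m - n)); [rewrite Rc; field|]; lra).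
  assert (Eb : poch (1 - b - INR m) n = s * poch b m / poch b (m - n))
    by (apply Rmult_eq_reg_l with (poch b (m - n)); [rewrite Rb; field|]; lra).
  unfold prod_poch; simpl map; simpl fold_right.
  rewrite E1, Ec, Eb; unfold Binomial.C, cweight.
  replace (poch c m) with (s * s * poch c m) at 2 by (rewrite Hs; ring).
  field; repeat split; try assumption; lra.
Qed.

Lemma pFq_4F3_finite (a b c e : R) (m : nat) : 0 < b -> 0 < c ->
  e <> 0 -> (forall n, (n <= m)%nat -> poch (- e) n <> 0) ->
  pFq (- INR m :: a :: 1 - c - INR m :: 1 - e :: nil)
      (c :: 1 - b - INR m :: - e :: nil) (-1) =
  poch c m / poch b m * sum_f_R0 (fun n => Binomial.C m n * cweight c m n *
    (poch a n * poch b (m - n)) * (1 - INR n / e)) m.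
Proof.
  intros Hb Hc He Hen; unfold pFq.
  set (f := fun n => prod_poch _ n / _ * _ / _).
  (* For integer [b] the symbol [(1-b-m)_n] may vanish here as well. The numerator is already zero,
     so the term is [0] whatever value division by zero takes. *)
  assert (Hz : forall n, (m < n)%nat -> f n = 0).
  { intros n Hn; unfold f, prod_poch; simpl map; simpl fold_right.
    rewrite poch_neg_nat_vanish by exact Hn; unfold Rdiv; ring. }
  rewrite (Series_incr_n f (S m)); [|lia|].
  - simpl Nat.pred.
    rewrite (Series_ext _ (fun k => 0 * 0)) by (intros k; rewrite Hz by lia; ring).
    rewrite Series_scal_l, Rmult_0_l, Rplus_0_r, <- sum_n_Reals, sum_n_Reals, scal_sum.
    apply sum_eq; intros n Hn; unfold f; rewrite pFq_4F3_term by auto; ring.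
  - apply (ex_series_incr_n f (S m)).
    apply ex_series_ext with (fun _ => 0).
    + intros k; symmetry; apply Hz; lia.
    + exists 0; apply filterlim_ext with (fun _ => 0); [|apply filterlim_const].
      intros k; rewrite sum_n_const; ring.
Qed.

(** The zeros in [e] are nonnegative integers, hence isolated; [e0] itself may be one of them, so
    the neighbourhood is punctured. *)
Lemma poch_neg_near (e0 : R) (m : nat) :
  exists eps : posreal, forall e, Rabs (e - e0) < eps -> e <> e0 ->
    forall n, (n <= m)%nat -> poch (- e) n <> 0.
Proof.
  induction m as [|m [eps IH]].
  - exists (mkposreal 1 Rlt_0_1); intros e _ _ n Hn.
    replace n with 0%nat by lia; simpl; lra.
  - assert (exists eps' : posreal, forall e, Rabs (e - e0) < eps' -> e <> e0 -> e <> INR m)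
      as [eps' He'].
    { destruct (Req_dec e0 (INR m)) as [-> |Hne].
      - exists (mkposreal 1 Rlt_0_1); auto.
      - assert (Hp : 0 < Rabs (INR m - e0)) by (apply Rabs_pos_lt; lra).
        exists (mkposreal _ Hp); simpl; intros e He _ ->; lra. }
    assert (Hp : 0 < Rmin eps eps') by (apply Rmin_pos; apply cond_pos).
    exists (mkposreal _ Hp); simpl; intros e He Hne n Hn.
    assert (H1 : Rabs (e - e0) < eps) by (apply Rlt_le_trans with (1 := He), Rmin_l).
    assert (H2 : Rabs (e - e0) < eps') by (apply Rlt_le_trans with (1 := He), Rmin_r).
    destruct (Nat.eq_dec n (S m)) as [-> |Hn']; [|apply (IH e H1 Hne); lia].
    simpl; apply Rmult_integral_contrapositive; split.
    + apply (IH e H1 Hne); lia.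
    + specialize (He' e H2 Hne); lra.
Qed.

Lemma pFq_4F3_lim (a b c : R) (m : nat) : 0 < a -> 0 < b -> 0 < c -> (0 < m)%nat ->
  is_lim (fun e => pFq (- INR m :: a :: 1 - c - INR m :: 1 - e :: nil)
                       (c :: 1 - b - INR m :: - e :: nil) (-1))
    (a * INR m / (a + b))
    (poch c m / poch b m * (b / INR m) *
       (cauchy_coef c a (b + 1) m - cauchy_coef c (a + 1) b m)).
Proof.
  intros Ha Hb Hc Hm; assert (Hm0 : 0 < INR m) by (apply lt_0_INR, Hm).
  set (e0 := a * INR m / (a + b)).
  assert (He0 : 0 < e0) by (apply Rdiv_lt_0_compat; nra).
  set (g := fun e => poch c m / poch b m * (sum_f_R0 (fun n => Binomial.C m n * cweight c m n *
    (poch a n * poch b (m - n))) m + sum_f_R0 (fun n => Binomial.C m n * cweight c m n *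
    (poch a n * poch b (m - n)) * - INR n) m * / e)).
  assert (Hg : forall e, g e = poch c m / poch b m *
    sum_f_R0 (fun n => Binomial.C m n * cweight c m n *
      (poch a n * poch b (m - n)) * (1 - INR n / e)) m).
  { intros e; unfold g; rewrite (Rmult_comm (sum_f_R0 _ m) (/ e)), scal_sum, <- plus_sum.
    f_equal; apply sum_eq; intros; unfold Rdiv; ring. }
  (* Termwise this is [(b+m-n)/b - (a+n)/a = (m/b) (1 - n/e0)] with [e0 = am/(a+b)]. *)
  assert (Hval : g e0 = poch c m / poch b m * (b / INR m) *
    (cauchy_coef c a (b + 1) m - cauchy_coef c (a + 1) b m)).
  { rewrite Hg, Rmult_assoc; f_equal; unfold cauchy_coef.
    rewrite <- minus_sum, scal_sum; apply sum_eq; intros n Hn.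
    assert (E1 : poch (a + 1) n = poch a n * (a + INR n) / a)
      by (rewrite <- poch_shift; field; lra).
    assert (E2 : poch (b + 1) (m - n) = poch b (m - n) * (b + INR (m - n)) / b)
      by (rewrite <- poch_shift; field; lra).
    rewrite E1, E2, minus_INR by exact Hn; unfold e0; field; repeat split; lra. }
  rewrite <- Hval.
  apply is_lim_ext_loc with g.
  - destruct (poch_neg_near e0 m) as [eps Heps].
    assert (Hp : 0 < Rmin eps e0) by (apply Rmin_pos; [apply cond_pos|exact He0]).
    exists (mkposreal _ Hp); intros e He Hne.
    unfold ball in He; simpl in He; unfold AbsRing_ball, abs, minus, plus, opp in He.
    simpl in He; fold (e - e0) in He.
    assert (H1 : Rabs (e - e0) < eps) by (apply Rlt_le_trans with (1 := He), Rmin_l).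
    assert (H2 : Rabs (e - e0) < e0) by (apply Rlt_le_trans with (1 := He), Rmin_r).
    apply Rabs_def2 in H2.
    rewrite Hg; symmetry; apply pFq_4F3_finite; auto; lra.
  - apply is_lim_continuity, continuity_pt_filterlim.
    change (continuous g e0).
    apply (@ex_derive_continuous R_AbsRing R_NormedModule).
    unfold g; auto_derive; lra.
Qed.

Theorem theorem4 (d : R) (hd : 0 < d) :
  (* (a) *)
  (forall a b c : R, 0 <= a -> a < b -> 0 < c ->
     exists coef : nat -> R,
       coef 0%nat = 0 /\ coef 1%nat = 0 /\
       (forall n : nat, (2 <= n)%nat -> 0 < coef n) /\
       (forall x : R, is_series (fun n => coef n * x ^ n)
          (F11 (a + d) c x * F11 b c x - F11 (b + d) c x * F11 a c x))) /\
  (* (b) monotonicity *)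
  (forall c x : R, 0 < c -> 0 < x ->
     forall a1 a2 : R, 0 <= a1 -> a1 <= a2 ->
       F11 (a2 + d) c x / F11 a2 c x <= F11 (a1 + d) c x / F11 a1 c x) /\
  (forall c x : R, 0 < c -> x < 0 ->
     forall a1 a2 : R, a1 <= a2 -> a2 <= c - d ->
       F11 (a2 + d) c x / F11 a2 c x <= F11 (a1 + d) c x / F11 a1 c x) /\
  (* (b) log-concavity *)
  (forall a c x : R, 0 < c -> 0 < x -> 0 <= a ->
     F11 a c x * F11 (a + 2 * d) c x <= F11 (a + d) c x ^ 2) /\
  (forall a c x : R, 0 < c -> x < 0 -> a + 2 * d <= c ->
     F11 a c x * F11 (a + 2 * d) c x <= F11 (a + d) c x ^ 2) /\
  (* (c) first inequality, with sharpness *)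
  (forall a b c : R, 0 < a -> a < b -> 0 < c ->
     (forall x : R, 0 < x ->
        Gamma (a + d) * Gamma b / (Gamma (b + d) * Gamma a) < kratio d a b c x /\
        kratio d a b c x < 1) /\
     kratio d a b c 0 = 1 /\
     is_lim (kratio d a b c) p_infty
       (Gamma (a + d) * Gamma b / (Gamma (b + d) * Gamma a))) /\
  (* (c) second inequality, with sharpness *)
  (forall a b c : R, a < b -> b < c - d -> 0 < c ->
     (forall x : R, x < 0 ->
        Gamma (c - a - d) * Gamma (c - b) / (Gamma (c - b - d) * Gamma (c - a))
          < kratio d a b c x /\
        kratio d a b c x < 1) /\
     kratio d a b c 0 = 1 /\
     is_lim (kratio d a b c) m_infty
       (Gamma (c - a - d) * Gamma (c - b) / (Gamma (c - b - d) * Gamma (c - a)))) /\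
  (* (d): the 4F3 at the parameter value e = a m/(a+b), understood by
     continuity in e (its removable singularities when a m/(a+b) is an integer
     are filled in by the limit e -> a m/(a+b)) *)
  (forall (a b c : R) (m : nat), 0 < b -> b < a -> 0 < c -> (2 <= m)%nat ->
     exists L : R,
       is_lim (fun e => pFq (- INR m :: a :: 1 - c - INR m :: 1 - e :: nil)
                            (c :: 1 - b - INR m :: - e :: nil) (-1))
              (a * INR m / (a + b)) L /\ 0 < L) /\
  (forall (a b c : R) (m : nat), 0 < a -> a < b -> 0 < c -> (2 <= m)%nat ->
     exists L : R,
       is_lim (fun e => pFq (- INR m :: a :: 1 - c - INR m :: 1 - e :: nil)
                            (c :: 1 - b - INR m :: - e :: nil) (-1))
              (a * INR m / (a + b)) L /\ L < 0).
Proof.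
  repeat match goal with |- _ /\ _ => split end.
  - intros a b c Ha Hab Hc.
    exists (fun m => (cauchy_coef c (a + d) b m - cauchy_coef c a (b + d) m) / INR (fact m)).
    repeat split.
    + rewrite turan_coef_vanish by auto; apply Rdiv_0_l.
    + rewrite turan_coef_vanish by auto; apply Rdiv_0_l.
    + intros n Hn; apply turan_coef_pos; assumption.
    + intros x; apply is_series_turan, Hc.
  - intros c x Hc Hx a1 a2 H1 H12; apply F11_ratio_le; assumption.
  - intros c x Hc Hx a1 a2 H12 H2; apply F11_ratio_le_neg; assumption.
  - intros a c x Hc Hx Ha.
    pose proof (F11_turan_le a (a + d) c d x Ha ltac:(lra) Hc hd Hx) as H.
    replace (a + 2 * d) with (a + d + d) by ring; lra.
  - intros a c x Hc Hx Ha.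
    rewrite (kummer_transformation a c x Hc), (kummer_transformation (a + d) c x Hc),
      (kummer_transformation (a + 2 * d) c x Hc).
    pose proof (F11_turan_le (c - (a + 2 * d)) (c - (a + d)) c d (- x)
      ltac:(lra) ltac:(lra) Hc hd ltac:(lra)) as H.
    replace (c - (a + d) + d) with (c - a) in H by ring.
    replace (c - (a + 2 * d) + d) with (c - (a + d)) in H by ring.
    pose proof (exp_pos x) as He.
    apply (Rmult_le_compat_l (exp x * exp x)) in H; [lra|].
    apply Rmult_le_pos; lra.
  - intros a b c Ha Hab Hc; repeat split.
    + apply gamma_ratio_lt_kratio; assumption.
    + apply kratio_lt_1; lra.
    + apply kratio_at_0, Hc.
    + apply is_lim_kratio; assumption.
  - intros a b c Hab Hbc Hc.
    assert (EL : Gamma (c - a - d) * Gamma (c - b) / (Gamma (c - b - d) * Gamma (c - a))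
      = gamma_ratio (c - b - d) (c - a - d) d).
    { unfold gamma_ratio.
      replace (c - b - d + d) with (c - b) by ring.
      replace (c - a - d + d) with (c - a) by ring.
      rewrite (Rmult_comm (Gamma (c - a - d))), (Rmult_comm (Gamma (c - b - d))).
      reflexivity. }
    rewrite EL; repeat split.
    + rewrite kratio_kummer by exact Hc; apply gamma_ratio_lt_kratio; lra.
    + rewrite kratio_kummer by exact Hc; apply kratio_lt_1; lra.
    + apply kratio_at_0, Hc.
    + apply is_lim_ext with (fun x => kratio d (c - b - d) (c - a - d) c (- x)).
      { intros x; symmetry; apply kratio_kummer, Hc. }
      apply is_lim_comp with p_infty.
      * apply is_lim_kratio; lra.
      * apply (is_lim_opp (fun x => x) m_infty m_infty), is_lim_id.
      * exists 0; intros x _; discriminate.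
  - intros a b c m Hb Hab Hc Hm; eexists; split; [apply pFq_4F3_lim; try lia; lra|].
    pose proof (cauchy_coef_balanced_lt b a c 1 m ltac:(lra) Hab Hc Rlt_0_1 Hm) as H.
    (* The inequality was taken with [a] and [b] exchanged, as [b < a] here; symmetry of the product
       restores the order of the limit formula. *)
    rewrite cauchy_coef_comm, (cauchy_coef_comm c (b + 1)) in H.
    assert (0 < INR m) by (apply lt_0_INR; lia).
    apply Rmult_lt_0_compat; [apply Rmult_lt_0_compat|lra];
      apply Rdiv_lt_0_compat; try apply poch_pos; assumption.
  - intros a b c m Ha Hab Hc Hm; eexists; split; [apply pFq_4F3_lim; try lia; lra|].
    pose proof (cauchy_coef_balanced_lt a b c 1 m ltac:(lra) Hab Hc Rlt_0_1 Hm) as H.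
    assert (0 < INR m) by (apply lt_0_INR; lia).
    assert (0 < poch c m / poch b m * (b / INR m)).
    { apply Rmult_lt_0_compat; apply Rdiv_lt_0_compat; try apply poch_pos; lra. }
    nra.
Qed.
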